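(* Let $H$ be a separable infinite-dimensional Hilbert space, and let $\mathcal{I}$ be the complete metric space of all isometric $C_0$-semigroups on $H$ with the metric $d$ given in the context. Then the set $\mathcal{S}_{\mathcal{I}}\subset\mathcal{I}$ of all weakly stable isometric semigroups is of first category in $\mathcal{I}$, and the set $\mathcal{W}_{\mathcal{I}}\subset\mathcal{I}$ of all almost weakly stable isometric semigroups is residual in $\mathcal{I}$.
   Context: Hilbert spaces are complex. An isometric $C_0$-semigroup on $H$ is a strongly continuous one-parameter semigroup $T(\cdot)=(T(t))_{t\geq 0}$ of (linear, not necessarily surjective) isometries on $H$. The metric on the set $\mathcal{I}$ of all isometric $C_0$-semigroups on $H$ is $$d(T(\cdot),S(\cdot)):=\sum_{n,j=1}^\infty \frac{\sup_{t\in[0,n]}\|T(t)x_j-S(t)x_j\|}{2^{j+n}\|x_j\|},\qquad T(\cdot),S(\cdot)\in\mathcal{I},$$ where $\{x_j\}_{j=1}^\infty$ is a fixed dense subset of $H$ with all $x_j\neq 0$. $T(\cdot)$ is weakly stable if $\lim_{t\to\infty}\langle T(t)x,y\rangle=0$ for every $x,y\in H$. $T(\cdot)$ is almost weakly stable if there is a (measurable) set $M\subset[0,\infty)$ of asymptotic density one, i.e. $\lim_{t\to\infty}\frac{\lambda(M\cap[0,t])}{t}=1$ with $\lambda$ the Lebesgue measure, such that $\lim_{t\to\infty,\,t\in M}\langle T(t)x,y\rangle=0$ for every $x,y\in H$. A subset of a metric space is of first category if it is a countable union of nowhere dense sets; it is residual if its complement is of first category. *)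

(* Defs.v *)
From HB Require Import structures.
From mathcomp Require Import all_boot all_order all_algebra.
From mathcomp Require Import all_classical all_reals all_analysis.
From mathcomp Require Import complex lra.

Set Implicit Arguments.
Unset Strict Implicit.
Unset Printing Implicit Defensive.

Import Order.TTheory GRing.Theory Num.Theory.
Import numFieldNormedType.Exports.

Local Open Scope classical_set_scope.
Local Open Scope complex_scope.
Local Open Scope ring_scope.

Section realnorm.
Context {R : realType} {H : normedModType R[i]}.
Implicit Types (u v : H).

(* Norms of a normedModType R[i] take their values in R[i]. *)
Definition realnorm v : R := complex.Re `|v|.

Lemma realnormE v : `|v| = (realnorm v)%:C.
Proof.
rewrite /realnorm; have := normr_ge0 v.
by case: `|v| => a b; rewrite lecE /= => /andP[/eqP ->].
Qed.

Lemma realnorm_ge0 v : 0 <= realnorm v.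
Proof. by rewrite -lecR -realnormE; exact: normr_ge0. Qed.

Lemma realnorm0 : realnorm 0 = 0.
Proof. by rewrite /realnorm normr0. Qed.

Lemma realnorm_eq0 v : realnorm v = 0 -> v = 0.
Proof. by move=> v0; apply/normr0_eq0; rewrite realnormE v0. Qed.

Lemma realnorm_gt0 v : v != 0 -> 0 < realnorm v.
Proof.
move=> v0; rewrite lt_neqAle realnorm_ge0 andbT eq_sym.
by apply/eqP => /realnorm_eq0/eqP; exact/negP.
Qed.

Lemma realnormD u v : realnorm (u + v) <= realnorm u + realnorm v.
Proof. by rewrite -lecR rmorphD/= -!realnormE ler_normD. Qed.

Lemma realnormB u v : realnorm (u - v) = realnorm (v - u).
Proof. by rewrite /realnorm distrC. Qed.

Lemma realnorm_distD w u v :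
  realnorm (u - v) <= realnorm (u - w) + realnorm (w - v).
Proof. by rewrite (le_trans _ (realnormD _ _))// addrA subrK. Qed.

Lemma realnorm_ball (u v : H) (e : R) : ball u e%:C v <-> realnorm (u - v) < e.
Proof.
by rewrite -ball_normE /ball_ /= realnormE ltcR.
Qed.

End realnorm.

Lemma posC (R : realType) (e : R[i]) : 0 < e -> exists2 r : R, 0 < r & e = r%:C.
Proof.
by case: e => a b; rewrite ltcE /= => /andP[/eqP-> a0]; exists a.
Qed.

(* reads a real t >= 0 as an element of {nonneg R}; it is only used under a
   restriction to t >= 0 or as t tends to +oo *)
Definition nngabs {R : realType} (t : R) : {nonneg R} := `|t|%:nng.

Section isometric_semigroup.
Context {R : realType} (H : completeNormedModType R[i]).

Record isoC0semigroup := IsoC0Semigroup {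
  sg :> {nonneg R} -> H -> H ;
  sg_linear : forall t, linear (sg t) ;
  sg_isometry : forall t v, `|sg t v| = `|v| ;
  sg0 : forall v, sg 0%:nng v = v ;
  sgD : forall s t v, sg (s%:num + t%:num)%:nng v = sg s (sg t v) ;
  sg_continuous : forall v,
    {within `[0, +oo[, continuous (fun t : R => sg (nngabs t) v)} }.

Record dense_seq := DenseSeq {
  dseq :> nat -> H ;
  dseq_dense : dense (range dseq) ;
  dseq_neq0 : forall j, dseq j != 0 }.

End isometric_semigroup.

Section distance.
Context {R : realType} {H : completeNormedModType R[i]}.
Implicit Types S T U : isoC0semigroup H.

Definition sup_diff S T (n : nat) (v : H) : R :=
  sup [set realnorm (S t v - T t v) | t in [set t : {nonneg R} | t%:num <= n%:R]].

(* the pair (n, j) of naturals stands for the pair (n + 1, j + 1) of indices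
   starting from 1 *)
Definition sg_dist (x : dense_seq H) S T : R :=
  fine (\esum_(p in [set: nat * nat])
    (sup_diff S T p.1.+1 (x p.2) /
      (2 ^+ (p.2.+1 + p.1.+1) * realnorm (x p.2)))%:E)%E.

Lemma sg_eq S T : (forall t v, S t v = T t v) -> S = T.
Proof.
case: S T => [S ? ? ? ? ?] [T ? ? ? ? ?] /= ST.
have {}ST : S = T by apply/funext => t; apply/funext => v.
by subst T; congr IsoC0Semigroup; exact: Prop_irrelevance.
Qed.

Lemma sg_realnorm S t v : realnorm (S t v) = realnorm v.
Proof. by rewrite /realnorm sg_isometry. Qed.

Lemma sgB S t u v : S t (u - v) = S t u - S t v.
Proof. exact: (additive_linear (sg_linear S t)). Qed.

Lemma sg_diff_le S T t v : realnorm (S t v - T t v) <= 2 * realnorm v.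
Proof.
rewrite (le_trans (realnorm_distD 0 _ _))// subr0 sub0r.
by rewrite {2}/realnorm normrN -/(realnorm _) !sg_realnorm mulr_natl.
Qed.

Lemma sg_diff_le_dist S T t u v :
  realnorm (S t u - T t u) <= realnorm (S t v - T t v) + 2 * realnorm (u - v).
Proof.
rewrite (le_trans (realnorm_distD (S t v) _ _))//.
rewrite (le_trans (lerD (lexx _) (realnorm_distD (T t v) _ _)))//.
rewrite -!sgB !sg_realnorm (realnormB v u) addrCA mulr_natl mulr2n.
by [].
Qed.

Let sup_diff_set S T (n : nat) (v : H) :=
  [set realnorm (S t v - T t v) | t in [set t : {nonneg R} | t%:num <= n%:R]].

Let sup_diff_set0 S T n v : (sup_diff_set S T n v) !=set0.
Proof. by exists (realnorm (S 0%:nng v - T 0%:nng v)), 0%:nng => /=. Qed.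

Let sup_diff_ub S T n v : ubound (sup_diff_set S T n v) (2 * realnorm v).
Proof. by move=> _ [t _ <-]; exact: sg_diff_le. Qed.

Lemma sup_diff_sup S T n v (t : {nonneg R}) :
  t%:num <= n%:R -> realnorm (S t v - T t v) <= sup_diff S T n v.
Proof.
move=> tn; apply: ub_le_sup; first by exists (2 * realnorm v); exact: sup_diff_ub.
by exists t.
Qed.

Lemma sup_diff_le S T n v (c : R) :
  (forall t : {nonneg R}, t%:num <= n%:R -> realnorm (S t v - T t v) <= c) ->
  sup_diff S T n v <= c.
Proof.
move=> h; apply: ge_sup => [|_ [t tn <-]]; last exact: h.
exact: sup_diff_set0.
Qed.

Lemma sup_diff_ge0 S T n v : 0 <= sup_diff S T n v.
Proof.
by rewrite (le_trans _ (@sup_diff_sup S T n v 0%:nng _))// realnorm_ge0.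
Qed.

Section dist_theory.
Variable x : dense_seq H.

Let w (p : nat * nat) : R := 2 ^+ (p.2.+1 + p.1.+1) * realnorm (x p.2).
Let c S T (p : nat * nat) : R := sup_diff S T p.1.+1 (x p.2) / w p.

Let w_gt0 p : 0 < w p.
Proof. by rewrite mulr_gt0 ?exprn_gt0// realnorm_gt0// dseq_neq0. Qed.

Let c_ge0 S T p : 0 <= c S T p.
Proof. by rewrite divr_ge0 ?sup_diff_ge0// ltW. Qed.

Let c_le S T p : c S T p <= 2 / 2 ^+ (p.2.+1 + p.1.+1).
Proof.
rewrite /c ler_pdivrMr// /w mulrA divfK ?expf_neq0//.
by apply: sup_diff_le => t _; exact: sg_diff_le.
Qed.

Let half_esum (r : R) (n : nat) : 0 <= r ->
  (\esum_(k in [set: nat]) (r / 2 ^+ (k + n.+1))%:E = (r / 2 ^+ n)%:E)%E.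
Proof.
move=> r0; rewrite -nneseries_esumT; last first.
  by move=> k; rewrite lee_fin divr_ge0// exprn_ge0.
apply/cvg_lim => //.
rewrite [X in X @ _ --> _](_ : _ =
    eseries (fun k => (r / (2 ^ (k + n.+1))%:R)%:E)).
  exact: cvg_geometric_eseries_half.
by apply/funext => k; apply: eq_bigr => i _; rewrite natrX.
Qed.

Let esum_c_le S T : (\esum_(p in [set: nat * nat]) (c S T p)%:E <= 2%:E)%E.
Proof.
apply: (@le_trans _ _
    (\esum_(p in [set: nat * nat]) (2 / 2 ^+ (p.2.+1 + p.1.+1))%:E)%E).
  by apply: le_esum => p _; rewrite lee_fin c_le.
have -> : [set: nat * nat] = [set: nat] `*`` (fun=> [set: nat]) by apply/seteqP.
rewrite -(@esum_esum _ _ _ _ _ (fun n j => (2 / 2 ^+ (j.+1 + n.+1))%:E)); last first.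
  by move=> n j _ _; rewrite lee_fin divr_ge0// exprn_ge0.
under eq_esum do under eq_esum do rewrite addSnnS.
under eq_esum => i _ do rewrite half_esum// -[i.+1]addn1.
by rewrite half_esum// divr1.
Qed.

Let dE S T :
  ((sg_dist x S T)%:E = \esum_(p in [set: nat * nat]) (c S T p)%:E)%E.
Proof.
rewrite /sg_dist fineK//; apply/fin_numPlt/andP; split.
  by rewrite (lt_le_trans (ltNyr 0))// esum_ge0// => p _; rewrite lee_fin c_ge0.
by rewrite (le_lt_trans (esum_c_le _ _))// ltry.
Qed.

Lemma sg_dist_ge0 S T : 0 <= sg_dist x S T.
Proof. by rewrite -lee_fin dE esum_ge0// => p _; rewrite lee_fin c_ge0. Qed.

Let c_dist S T p : c S T p <= sg_dist x S T.
Proof.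
rewrite -lee_fin dE; apply: esum_ge; exists [set p].
  by split => //; exact: finite_set1.
by rewrite fsbig_set1.
Qed.

Lemma sg_dist_xx S : sg_dist x S S = 0.
Proof.
apply/eqP; rewrite eq_le sg_dist_ge0 andbT -lee_fin dE esum1// => p _.
congr EFin; apply/eqP; rewrite eq_le c_ge0 andbT /c pmulr_lle0 ?invr_gt0//.
by apply: sup_diff_le => t _; rewrite subrr realnorm0.
Qed.

Lemma sg_dist_sym S T : sg_dist x S T = sg_dist x T S.
Proof.
rewrite /sg_dist; congr (fine (esum _ _)); apply/funext => p.
congr ((sup _ / _)%:E); congr (_ @` _); apply/funext => t.
exact: realnormB.
Qed.

Let c_triangle S T U p : c S U p <= c S T p + c T U p.
Proof.
rewrite /c -mulrDl ler_wpM2r ?invr_ge0 ?(ltW (w_gt0 _))//.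
apply: sup_diff_le => t tn; rewrite (le_trans (realnorm_distD (T t (x p.2)) _ _))//.
by rewrite lerD// sup_diff_sup.
Qed.

Lemma sg_dist_triangle S T U : sg_dist x T U <= sg_dist x T S + sg_dist x S U.
Proof.
rewrite -lee_fin EFinD !dE -esumD; try by move=> p _; rewrite lee_fin c_ge0.
by apply: le_esum => p _; rewrite -EFinD lee_fin c_triangle.
Qed.

Lemma dense_seq_approx (v : H) (e : R) :
  0 < e -> exists j, realnorm (v - x j) < e.
Proof.
move=> e0; have e0C : 0 < e%:C by rewrite ltcR.
have := @dseq_dense _ _ x (ball v e%:C)°.
case.
- exists v; exact: nbhsx_ballx.
- exact: open_interior.
by move=> y [/interior_subset/realnorm_ball vy [j _ xj]]; exists j; rewrite xj.
Qed.

Lemma sg_dist_eq0 S T : sg_dist x S T = 0 -> S = T.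
Proof.
move=> d0; apply: sg_eq => t v; apply/eqP; rewrite -subr_eq0; apply/eqP.
apply: realnorm_eq0; apply/eqP; rewrite eq_le realnorm_ge0 andbT.
apply/ler_addgt0Pl => e e0; rewrite addr0.
have [j vj] := dense_seq_approx v (divr_gt0 e0 (ltr0n _ 2)).
rewrite (le_trans (sg_diff_le_dist _ _ _ _ (x j)))//.
have : realnorm (S t (x j) - T t (x j)) <= 0.
  have [n tn] : exists n : nat, t%:num <= n.+1%:R.
    by exists (Num.truncn t%:num); rewrite ltW// truncnS_gt.
  rewrite (le_trans (sup_diff_sup _ _ _ tn))//.
  have := c_dist S T (n, j); rewrite d0 /c /=.
  by rewrite pmulr_lle0 ?invr_gt0.
lra.
Qed.

Let unif S T (N : nat) (v : H) (e : R) :=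
  forall t : {nonneg R}, t%:num <= N%:R -> realnorm (S t v - T t v) <= e.

Let c_near (F : set_system (isoC0semigroup H)) (FF : ProperFilter F)
    (L : isoC0semigroup H) :
  (forall v (N : nat) (e : R), 0 < e -> \forall S \near F, unif S L N v e) ->
  (forall e : R, 0 < e -> exists S0, \forall S \near F, sg_dist x S0 S < e) ->
  forall e : R, 0 < e -> \forall S \near F, sg_dist x S L <= e.
Proof.
move=> FL Fc e e0.
have c_lim p d : 0 < d -> \forall S \near F, c S L p <= d.
  move=> d0; near=> S; rewrite /c ler_pdivrMr//; apply: sup_diff_le.
  near: S; apply: FL; exact: mulr_gt0.
have s_lim (s : seq (nat * nat)) : forall d, 0 < d ->
    \forall S \near F, \sum_(p <- s) c S L p <= d.
  elim: s => [|p s IH] d d0.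
    by near=> S; rewrite big_nil ltW.
  near=> S; rewrite big_cons [d]splitr lerD//.
    by near: S; apply: c_lim; rewrite divr_gt0.
  by near: S; apply: IH; rewrite divr_gt0.
have [S0 FS0] := Fc _ (divr_gt0 e0 (ltr0n _ 2)).
near=> S; have dS : sg_dist x S0 S < e / 2 by near: S.
rewrite -lee_fin dE; apply: ge_ereal_sup => _ [X [finX _] <-].
rewrite fsbig_finite//= sumEFin lee_fin; apply/ler_addgt0Pl => d d0.
near F => T.
have dT : sg_dist x S0 T < e / 2 by near: T.
have dST : sg_dist x S T <= e.
  rewrite (le_trans (sg_dist_triangle S0 _ _))// (sg_dist_sym S) [e]splitr.
  by rewrite lerD// ltW.
have cST : \sum_(p <- finmap.enum_fset (fset_set X)) c S T p <= sg_dist x S T.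
  rewrite -lee_fin -sumEFin dE; apply: esum_ge; exists X => //.
  by rewrite fsbig_finite.
have cTL : \sum_(p <- finmap.enum_fset (fset_set X)) c T L p <= d.
  by near: T; exact: s_lim.
rewrite (le_trans _ (lerD cTL (le_trans cST dST)))// addrC -big_split/=.
by apply: ler_sum => p _; exact: c_triangle.
Unshelve. all: by end_near. Qed.

Let near_pointwise (F : set_system (isoC0semigroup H)) (FF : ProperFilter F) :
  (forall e : R, 0 < e -> exists S0, \forall S \near F, sg_dist x S0 S < e) ->
  forall v (N : nat) (e : R), 0 < e -> exists S0 : isoC0semigroup H, \forall S \near F,
    unif S0 S N v e.
Proof.
move=> Fc v N e e0.
have e4 : 0 < e / 4 by rewrite divr_gt0.
have [j vj] := dense_seq_approx v e4.
have e2 : 0 < e / 2 / w (N, j) by rewrite !divr_gt0.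
have [S0 FS0] := Fc _ e2; exists S0; near=> S => t tN.
rewrite (le_trans (sg_diff_le_dist _ _ _ _ (x j)))//.
have : realnorm (S0 t (x j) - S t (x j)) <= e / 2.
  have tN1 : t%:num <= N.+1%:R by rewrite (le_trans tN)// ler_nat.
  rewrite (le_trans (sup_diff_sup _ _ _ tN1))//.
  rewrite -[leLHS](@divfK _ (w (N, j))) ?gt_eqF// -ler_pdivlMr//.
  rewrite (le_trans (c_dist S0 S (N, j)))// ltW//.
  by near: S.
have := vj; lra.
Unshelve. all: by end_near. Qed.

Lemma sg_complete (F : set_system (isoC0semigroup H)) : ProperFilter F ->
  (forall e : R, 0 < e -> exists S0, \forall S \near F, sg_dist x S0 S < e) ->
  exists L, forall e : R, 0 < e -> \forall S \near F, sg_dist x S L <= e.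
Proof.
move=> FF Fc.
have npos (t : {nonneg R}) : exists N : nat, t%:num <= N%:R.
  by exists (Num.truncn t%:num).+1; rewrite ltW// truncnS_gt.
have cvgF (t : {nonneg R}) (v : H) :
    cvg ((fun S : isoC0semigroup H => S t v) @ F).
  apply/cauchy_cvgP/cauchyP => _ /posC[e e0 ->].
  have [N tN] := npos t.
  have [S0 FS0] := near_pointwise FF Fc v N (divr_gt0 e0 (ltr0n _ 2)).
  exists (S0 t v); apply: (@filterS _ F _ _ _ _ FS0) => S S0S /=.
  apply/realnorm_ball; rewrite (le_lt_trans (S0S _ tN))//.
  by rewrite ltr_pdivrMr// ltr_pMr// ltr1n.
pose L (t : {nonneg R}) (v : H) : H :=
  lim ((fun S : isoC0semigroup H => S t v) @ F).
have limL t v (e : R) : 0 < e ->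
    \forall S \near F, realnorm ((S : isoC0semigroup H) t v - L t v) <= e.
  move=> e0; have e0C : 0 < e%:C by rewrite ltcR.
  have /cvgrPdist_le/(_ _ e0C) := cvgF t v.
  by apply: filterS => S; rewrite realnormE lecR realnormB.
have uniL v (N : nat) (e : R) : 0 < e -> \forall S \near F,
    forall t : {nonneg R}, t%:num <= N%:R ->
    realnorm ((S : isoC0semigroup H) t v - L t v) <= e.
  move=> e0; have [S0 FS0] := near_pointwise FF Fc v N (divr_gt0 e0 (ltr0n _ 2)).
  near=> S => t tN; apply/ler_addgt0Pl => d d0.
  near F => T.
  have ST : realnorm (S0 t v - S t v) <= e / 2.
    have : unif S0 S N v (e / 2) by near: S.
    exact.
  have TT : realnorm (S0 t v - T t v) <= e / 2.
    have : unif S0 T N v (e / 2) by near: T.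
    exact.
  have TL : realnorm (T t v - L t v) <= d by near: T; exact: limL.
  rewrite (le_trans (realnorm_distD (S0 t v) _ _))//.
  rewrite realnormB.
  have := realnorm_distD (T t v) (S0 t v) (L t v).
  lra.
have eq_norm0 (u v : H) : (forall e : R, 0 < e -> realnorm (u - v) <= e) -> u = v.
  move=> h; apply/eqP; rewrite -subr_eq0; apply/eqP/realnorm_eq0/eqP.
  by rewrite eq_le realnorm_ge0 andbT; apply/ler_addgt0Pl => e /h; rewrite addr0.
have L_linear t : linear (L t).
  move=> a u v; apply/(cvg_lim (@norm_hausdorff _ _)).
  under eq_fun do rewrite sg_linear.
  by apply: cvgD; [apply: cvgZr|]; exact: cvgF.
have L_iso t v : `|L t v| = `|v|.
  rewrite !realnormE; congr (_%:C).
  apply/eqP; rewrite eq_le; apply/andP; split; apply/ler_addgt0Pl => e e0;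
    near F => S; rewrite -(sg_realnorm S t v);
    have SL : realnorm (S t v - L t v) <= e by near: S; exact: limL.
  - have := realnormD (L t v - S t v) (S t v).
    by rewrite subrK realnormB; move: SL; lra.
  - have := realnormD (S t v - L t v) (L t v).
    by rewrite subrK; move: SL; lra.
have L0 v : L 0%:nng v = v.
  apply/(cvg_lim (@norm_hausdorff _ _)).
  by under eq_fun do rewrite sg0; exact: cvg_cst.
have LB t u v : L t (u - v) = L t u - L t v.
  exact: (additive_linear (L_linear t)).
have LD s t v : L (s%:num + t%:num)%:nng v = L s (L t v).
  apply: eq_norm0 => e e0; have e3 : 0 < e / 3 by rewrite divr_gt0.
  near F => S.
  have h1 : realnorm (S (s%:num + t%:num)%:nng v - L (s%:num + t%:num)%:nng v)
    <= e / 3 by near: S; exact: limL.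
  have h2 : realnorm (S t v - L t v) <= e / 3 by near: S; exact: limL.
  have h3 : realnorm (S s (L t v) - L s (L t v)) <= e / 3.
    by near: S; exact: limL.
  rewrite sgD in h1.
  rewrite -(sg_realnorm S s) sgB in h2.
  rewrite (le_trans (realnorm_distD (S s (S t v)) _ _))// realnormB.
  have := realnorm_distD (S s (L t v)) (S s (S t v)) (L s (L t v)).
  lra.
have Lcont v : {within `[0, +oo[, continuous (fun t : R => L (nngabs t) v)}.
  apply/subspace_continuousP => t0 /=; rewrite in_itv/= andbT => t00.
  apply/cvgrPdist_le => _ /posC[e e0 ->].
  have e3 : 0 < e / 3 by rewrite divr_gt0.
  pose N := (Num.truncn (t0 + 1)).+1.
  have t0N : t0 + 1 <= N%:R by rewrite ltW// truncnS_gt.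
  near F => S.
  have SL (t : R) : `|t| <= N%:R -> realnorm (S (nngabs t) v - L (nngabs t) v) <= e / 3.
    have SLN : forall r : {nonneg R}, r%:num <= N%:R ->
        realnorm (S r v - L r v) <= e / 3 by near: S; exact: uniL.
    by move=> tN; exact: SLN.
  have /subspace_continuousP/(_ t0) := @sg_continuous _ _ S v.
  rewrite /= in_itv/= andbT => /(_ t00)/cvgrPdist_le.
  have e3C : 0 < (e / 3)%:C by rewrite ltcR.
  move=> /(_ _ e3C) Sc.
  have near1 : nbhs t0 [set t | `|t0 - t| <= 1].
    have /cvgrPdist_le : id @ nbhs t0 --> t0 by exact: cvg_id.
    by apply.
  near=> t; rewrite realnormE lecR.
  have h1 : realnorm (S (nngabs t0) v - S (nngabs t) v) <= e / 3.
    by rewrite -lecR -realnormE; near: t.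
  have h2 : realnorm (S (nngabs t) v - L (nngabs t) v) <= e / 3.
    apply: SL; rewrite (le_trans _ t0N)//.
    have tt0 : `|t0 - t| <= 1.
      by near: t; exact: (@cvg_within _ (nbhs t0) _ _ _ near1).
    have := ler_normB t0 (t0 - t); rewrite subKr (ger0_norm t00).
    by move: tt0; lra.
  have h3 : realnorm (S (nngabs t0) v - L (nngabs t0) v) <= e / 3.
    by apply: SL; rewrite ger0_norm// (le_trans _ t0N)// lerDl.
  pose r := nngabs t; pose r0 := nngabs t0.
  suff : realnorm (L r0 v - L r v) <= e by [].
  rewrite (le_trans (realnorm_distD (S r0 v) _ _))// realnormB.
  have := realnorm_distD (S r v) (S r0 v) (L r v).
  by move: h1 h2 h3; rewrite -/r -/r0; lra.
exists (IsoC0Semigroup L_linear L_iso L0 LD Lcont).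
exact: c_near.
Unshelve. all: by end_near. Qed.

End dist_theory.
End distance.

Section complete_metric.
Context {R : realType} {H : completeNormedModType R[i]}.

(* isoC0semigroup H, with the metric determined by the sequence x *)
Definition isoSg (x : dense_seq H) : Type := isoC0semigroup H.

HB.instance Definition _ x := gen_eqMixin (isoSg x).
HB.instance Definition _ x := gen_choiceMixin (isoSg x).
HB.instance Definition _ x := @isMetric.Build R (isoSg x) (sg_dist x)
  (sg_dist_xx x) (@sg_dist_eq0 R H x) (sg_dist_sym x) (sg_dist_triangle x).

Lemma id_sg_continuous (v : H) :
  {within `[0, +oo[, continuous (fun t : R => v)}.
Proof. by move=> t; exact: cvg_cst. Qed.

Definition id_sg : isoC0semigroup H :=
  @IsoC0Semigroup R H (fun _ v => v) (fun _ _ _ _ => erefl) (fun _ _ => erefl)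
    (fun _ => erefl) (fun _ _ _ => erefl) id_sg_continuous.

HB.instance Definition _ x := isPointed.Build (isoSg x) id_sg.

Lemma isoSg_complete (x : dense_seq H) (F : set_system (isoSg x)) :
  ProperFilter F -> cauchy F -> cvg F.
Proof.
move=> FF /cauchyP Fc.
have [|L FL] := @sg_complete R H x F FF.
  by move=> e /Fc[S FS]; exists S; move: FS; rewrite ballEmdist.
apply/cvg_ex; exists (L : isoSg x); apply/cvg_ballP => e e0.
have e2 : 0 < e / 2 by rewrite divr_gt0.
apply: filterS (FL _ e2) => S SL.
rewrite ballEmdist /= metric_sym (le_lt_trans SL)//.
by rewrite ltr_pdivrMr// ltr_pMr// ltr1n.
Qed.

HB.instance Definition _ x :=
  Uniform_isComplete.Build (isoSg x) (@isoSg_complete x).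

End complete_metric.

Definition separable (X : topologicalType) : Prop :=
  exists A : set X, countable A /\ dense A.

Section category.
Context {X : topologicalType}.
Implicit Types A : set X.

Definition nowhere_dense A : Prop := (closure A)° = set0.

Definition first_category A : Prop :=
  exists F : nat -> set X, (forall n, nowhere_dense (F n)) /\ A = \bigcup_n F n.

Definition residual A : Prop := first_category (~` A).

End category.

Definition infinite_dimensional (K : fieldType) (V : lmodType K) : Prop :=
  ~ exists (n : nat) (b : 'I_n -> V),
      forall v, exists a : 'I_n -> K, v = \sum_(i < n) a i *: b i.

Section stability.
Context {R : realType} {H : completeNormedModType R[i]}.
Variable dot : {dot H for @Num.conj R[i]}.
Implicit Types T : isoC0semigroup H.

Definition weakly_stable T : Prop := forall u v : H,
  (dot (T (nngabs t) u) v : R[i]^o) @[t --> (+oo : set_system R)] --> (0 : R[i]^o).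

Definition asymptotic_density_one (M : set R) : Prop :=
  fine (lebesgue_measure (M `&` `[0, t])) / t @[t --> +oo] --> (1 : R).

Definition almost_weakly_stable T : Prop := exists M : set R,
  [/\ measurable M, M `<=` `[0, +oo[, asymptotic_density_one M &
      forall u v : H,
        (dot (T (nngabs t) u) v : R[i]^o) @[t --> within M +oo] --> (0 : R[i]^o)].

End stability.

(* Main.v *)
From HB Require Import structures.
Require Import Defs.
From mathcomp Require Import all_boot all_order all_algebra.
From mathcomp Require Import all_classical all_reals all_analysis.
From mathcomp Require Import complex lra ring zify.
Import Order.TTheory GRing.Theory Num.Theory.
Import numFieldNormedType.Exports.
Local Open Scope classical_set_scope.
Local Open Scope complex_scope.
Local Open Scope ring_scope.

(** Both halves rest on one density statement, periodic_approx: near every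
isometric semigroup T there is a semigroup S which is periodic, with a period
as large as desired, and which spreads finitely many given vectors, in the
sense that for some n the quantity

      gram_energy S u n = sum over r, s < n of |<S(r)u, S(s)u>|^2

is at most n^2 |u|^4 / D, where D is prescribed.

A weakly stable semigroup belongs, for m large, to the set of all T such that
|<T(t)u, u>| <= |u|^2/2 whenever t >= m.  A periodic S satisfies S(t)u = u at
arbitrarily large times, so a neighbourhood of S misses this set: the set is
nowhere dense, which gives the first category.

For the second half, let C_k be the set of the T such that no n >= 1 gives
gram_energy T (x j) n <= n^2 |x_j|^4 / (k+1)^2 simultaneously for all j <= k.
The spreading semigroups S show that C_k is nowhere dense.  If T lies in no
C_k, then T is almost weakly stable (almost_weakly_stable_of_energy), by means
of the discrete times only.  By a Bessel type inequality
(sum_sqr_dot_le_energy), the sum over i < n of |<T(i)u, y>|^2 is at most |y|^2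
times the square root of the energy of u; as the T(m) are isometries, the same
bound holds for the block of times m, ..., m + n - 1, for every m.  Small
energies therefore force the set of the times i at which |<T(i)x_j, x_l>|
exceeds a threshold to have density zero.  A diagonal argument
(diagonal_density) produces one exceptional set B of density zero for all pairs
of vectors, and the union of the intervals [i, i + 1[ with i outside B has
density one; between integers, T(i + s)u = T(i)T(s)u where T(s)u ranges over a
compact set.

The density statement is proved without the spectral theorem.  Let h be a small
step, V = T(h), q = 2p + 1 large, and let

      J_k u = (1/q) sum over m < q of e^{-i m phi_k} V^m u,
      phi_k = 2 pi (k - p) / q.

The map u |-> (J_k u)_k is an isometry of H into H^q (fourier_coef_Gram), and
multiplication by e^{i phi_k} in the k-th coordinate, which has order q, agrees
with V under this embedding up to an error 2|u|/sqrt q (fourier_coef_shift).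
The real powers e^{i phi_k t/h} interpolate it by a periodic unitary group, and
because |phi_k| <= pi these powers move a vector, for t between 0 and h, at most
as far as at t = h; so T is followed at all times of a bounded interval.
Splitting each coordinate into D copies whose frequencies differ by multiples of
a very small delta spreads all vectors (dft_energy).

This takes place in H^q, and has to be transported to H.  Only finitely many
vectors v_i matter, hence only finitely many coordinates, and everything reduces
to Gram matrices: semigroup_of_Gram realizes inside H any family of vectors with
prescribed frequency components, because H contains arbitrarily large finite
orthonormal families and because two finite families with the same Gram matrix
are exchanged by a product of reflections (isometry_of_Gram). *)

(** * Complex modulus and the unit circle *)

Section cmod.
Context {R : realType}.
Implicit Types (z w : R[i]) (a b : R).

Definition cmod z : R := complex.Re `|z|.

Lemma cmodE z : `|z| = (cmod z)%:C. Proof. by []. Qed.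

Lemma cmod_ge0 z : 0 <= cmod z.
Proof. by rewrite -lecR -cmodE normr_ge0. Qed.

Lemma cmodM z w : cmod (z * w) = cmod z * cmod w.
Proof. by apply: complexI; rewrite rmorphM /= -!cmodE normrM. Qed.

Lemma cmodJ z : cmod z^* = cmod z.
Proof. by apply: complexI; rewrite -!cmodE normcJ. Qed.

Lemma cmodD z w : cmod (z + w) <= cmod z + cmod w.
Proof. by rewrite -lecR rmorphD /= -!cmodE ler_normD. Qed.

Lemma cmodN z : cmod (- z) = cmod z.
Proof. by rewrite /cmod normrN. Qed.

Lemma cmod_sum (I : Type) (r : seq I) (P : pred I) (F : I -> R[i]) :
  cmod (\sum_(i <- r | P i) F i) <= \sum_(i <- r | P i) cmod (F i).
Proof. by rewrite -lecR rmorph_sum /= -cmodE ler_norm_sum. Qed.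

Lemma cmod_real a : cmod a%:C = `|a|.
Proof. by rewrite /cmod normc_def /= expr0n /= addr0 sqrtr_sqr. Qed.

Lemma sqr_cmod z : (cmod z ^+ 2)%:C = z * z^*.
Proof. by rewrite rmorphXn /= -cmodE sqr_normc. Qed.

Lemma sqr_cmodE z : cmod z ^+ 2 = complex.Re z ^+ 2 + complex.Im z ^+ 2.
Proof. by apply: complexI; rewrite rmorphXn /= -cmodE -add_Re2_Im2. Qed.

Lemma Re_le_cmod z : complex.Re z <= cmod z.
Proof.
have := normc_ge_Re z; rewrite cmodE lecR; exact/le_trans/ler_norm.
Qed.

End cmod.

Section cis.
Context {R : realType}.
Implicit Types (a b : R).

Definition cis a : R[i] := cos a +i* sin a.

Lemma cis0 : cis 0 = 1. Proof. by rewrite /cis cos0 sin0. Qed.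

Lemma cisD a b : cis (a + b) = cis a * cis b.
Proof. by rewrite /cis cosD sinD; simpc; congr (_ +i* _); ring. Qed.

Lemma cisN a : cis (- a) = (cis a)^*.
Proof. by rewrite /cis cosN sinN. Qed.

Lemma cisB a b : cis (a - b) = cis a * (cis b)^*.
Proof. by rewrite cisD cisN. Qed.

Lemma cmod_cis a : cmod (cis a) = 1.
Proof.
by apply/eqP; rewrite -sqrp_eq1 ?cmod_ge0// sqr_cmodE /= cos2Dsin2.
Qed.

Lemma cis_mulJ a : cis a * (cis a)^* = 1.
Proof. by rewrite -sqr_cmod cmod_cis expr1n. Qed.

Lemma cisX a n : cis (a * n%:R) = cis a ^+ n.
Proof.
elim: n => [|n IH]; first by rewrite mulr0 cis0.
by rewrite -natr1 mulrDr mulr1 cisD IH exprSr.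
Qed.

Lemma cis2pi : cis (pi *+ 2) = 1.
Proof. by rewrite /cis cos2pi sin2pi. Qed.

Lemma cis_2pin n : cis (pi *+ 2 * n%:R) = 1.
Proof. by rewrite cisX cis2pi expr1n. Qed.

Lemma sqr_cmod_cisB1 a : cmod (cis a - 1) ^+ 2 = 2 - 2 * cos a.
Proof.
rewrite sqr_cmodE /= subr0; have := cos2Dsin2 a; set c := cos a; set s := sin a.
by move=> cs; rewrite -[s ^+ 2](addKr (c ^+ 2)) cs; ring.
Qed.

(** If cos a = 1 then sin (a/2) = 0, although a/2 lies strictly between 0 and pi. *)
Lemma cis_eq1 a : 0 < a < pi *+ 2 -> cis a != 1.
Proof.
move=> /andP[a0 a2]; apply/eqP => -[ca sa].
have : sin (a / 2) = 0.
  apply/eqP; rewrite -sqrf_eq0; apply/eqP.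
  have := cos_mulr2n (a / 2); rewrite -(mulr_natr (a / 2)) divfK// ca.
  by rewrite cos2sin2 -mulr_natr; lra.
apply/eqP; rewrite gt_eqF// sin_gt0_pi// divr_gt0//=.
by rewrite ltr_pdivrMr// mulr_natr.
Qed.

Lemma sin_le_id a : 0 <= a -> sin a <= a.
Proof.
move=> a0; have [|c _] := @MVT_segment R sin cos 0 a a0.
  by apply: continuous_subspaceT => x; exact: continuous_sin.
rewrite sin0 !subr0 => ->.
by rewrite ler_piMl// cos_le1.
Qed.

(** The chord is at most the arc: |e^{ia} - 1| = 2 |sin (a/2)|. *)
Lemma cmod_cisB1_le a : cmod (cis a - 1) <= `|a|.
Proof.
rewrite -(@ler_pXn2r _ 2) ?nnegrE ?cmod_ge0// sqr_cmod_cisB1.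
have -> : cos a = cos (`|a| / 2 *+ 2) by rewrite -(mulr_natr (_ / _)) divfK// cos_norm.
rewrite cos_mulr2n cos2sin2.
set b := `|a| / 2; have -> : `|a| = b * 2 by rewrite divfK.
have b0 : 0 <= b by rewrite divr_ge0.
rewrite -mulr_natr.
have : sin b ^+ 2 <= b ^+ 2.
  rewrite -[sin b ^+ 2]real_normK ?num_real// (@ler_pXn2r _ 2) ?nnegrE// ler_norml sin_le_id// andbT.
  have [b1|b1] := leP b 1; last by have := sin_geN1 b; lra.
  apply: (@le_trans _ _ 0); first by rewrite oppr_le0.
  apply: sin_ge0_pi; rewrite b0 (le_trans b1)//.
  by have := pi_ge2 R; lra.
nra.
Qed.

Lemma cmod_cisB_le a b : cmod (cis a - cis b) <= `|a - b|.
Proof.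
have -> : cis a - cis b = cis b * (cis (a - b) - 1).
  by rewrite mulrBr mulr1 -cisD (addrC b) subrK.
by rewrite cmodM cmod_cis mul1r cmod_cisB1_le.
Qed.

(** Up to half a turn, longer arcs have longer chords.  This is what makes the
interpolation between two multiples of the time step harmless. *)
Lemma cmod_cisB1_homo a b : `|a| <= `|b| -> `|b| <= pi ->
  cmod (cis a - 1) <= cmod (cis b - 1).
Proof.
move=> ab bp; rewrite -(@ler_pXn2r _ 2) ?nnegrE ?cmod_ge0// !sqr_cmod_cisB1.
rewrite -(cos_norm a) -(cos_norm b).
have : cos `|b| <= cos `|a|; last by lra.
by rewrite leNgt ltr_cos -?leNgt// ?in_itv /= ?normr_ge0 ?(le_trans ab)//=.
Qed.

Lemma sum_cis_geom (a : R) q : cis a != 1 -> cis (a * q%:R) = 1 ->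
  \sum_(k < q) cis (a * k%:R) = 0.
Proof.
move=> a1 aq; have := subrX1 (cis a) q.
rewrite -cisX aq subrr => /esym/eqP; rewrite mulf_eq0 subr_eq0 (negPf a1) /=.
by move=> /eqP; under eq_bigr do rewrite -cisX.
Qed.

End cis.

(** * Finite Fourier sums *)

Section dft.
Context {R : realType}.

(** Orthogonality of the characters of the cyclic group of order n: for distinct
indices the sum is geometric with a ratio different from 1. *)
Lemma dft_orth (n d d' : nat) : (d < n)%N -> (d' < n)%N ->
  \sum_(r < n) cis (pi *+ 2 / n%:R * (d%:R - d'%:R) * r%:R) =
    n%:R * (d == d')%:R :> R[i].
Proof.
have lt d1 d2 : (d1 < n)%N -> (d2 < d1)%N ->
    \sum_(r < n) cis (pi *+ 2 / n%:R * (d1%:R - d2%:R) * r%:R) = 0 :> R[i].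
  move=> d1n d21; have n0 : 0 < n%:R :> R by rewrite ltr0n (leq_ltn_trans _ d1n).
  have pi2 : 0 < pi *+ 2 :> R by rewrite mulrn_wgt0// pi_gt0.
  have d0 : 0 < d1%:R - d2%:R :> R by rewrite subr_gt0 ltr_nat.
  apply: sum_cis_geom.
    apply: cis_eq1; rewrite mulr_gt0 ?divr_gt0//=.
    rewrite mulrAC ltr_pdivrMr// ltr_pM2l// ltrBlDr (lt_le_trans (y := n%:R))//.
      by rewrite ltr_nat.
    by rewrite lerDl.
  rewrite mulrAC divfK ?gt_eqF// -natrB; last exact: ltnW.
  exact: cis_2pin.
move=> dn dn'; have [dd|dd|->] := ltngtP d d'.
- have := congr1 conjc (lt d' d dn' dd); rewrite mulr0 rmorph0 rmorph_sum; apply: etrans.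
  apply: eq_bigr => r _; rewrite -[RHS]cisN; congr cis.
  by rewrite -mulNr -mulrN opprB.
- by rewrite mulr0 lt.
- under eq_bigr do rewrite subrr mulr0 mul0r cis0.
  by rewrite sumr_const card_ord mulr1.
Qed.


(** The square of the sum over m expands into pairs (m, m'), each of which
contributes the squared modulus of a character sum, so that only the D diagonal
pairs survive.  Compared with the trivial bound D^2 n^2 there is a gain of a
factor D, which is the mixing effect of D equidistant frequencies. *)
Lemma dft_energy (n D : nat) : (D <= n)%N ->
  \sum_(r < n) \sum_(s < n)
    cmod (\sum_(m < D) cis (pi *+ 2 / n%:R * m%:R * (r%:R - s%:R))) ^+ 2 =
  D%:R * n%:R ^+ 2 :> R.
Proof.
move=> Dn; apply: complexI; rewrite !rmorph_sum /=.
pose z (m m' : 'I_D) : R[i] :=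
  \sum_(r < n) cis (pi *+ 2 / n%:R * (m%:R - m'%:R) * r%:R).
have zE m m' : z m m' = n%:R * (m == m')%:R.
  by rewrite /z dft_orth ?(leq_trans (ltn_ord _))// (inj_eq val_inj).
transitivity (\sum_m \sum_m' z m m' * (z m m')^*).
  under eq_bigr => r _ do rewrite rmorph_sum /=.
  transitivity (\sum_(r < n) \sum_(s < n) \sum_(m < D) \sum_(m' < D)
    cis (pi *+ 2 / n%:R * (m%:R - m'%:R) * r%:R) *
    (cis (pi *+ 2 / n%:R * (m%:R - m'%:R) * s%:R))^* : R[i]).
    apply: eq_bigr => r _; apply: eq_bigr => s _.
    rewrite sqr_cmod rmorph_sum mulr_suml; apply: eq_bigr => m _.
    rewrite mulr_sumr; apply: eq_bigr => m' _.
    by rewrite -!cisB; congr cis; ring.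
  under eq_bigr do rewrite exchange_big /=.
  rewrite exchange_big /=; apply: eq_bigr => m _.
  under eq_bigr do rewrite exchange_big /=.
  rewrite exchange_big /=; apply: eq_bigr => m' _.
  rewrite /z rmorph_sum mulr_suml; apply: eq_bigr => r _.
  by rewrite mulr_sumr.
transitivity (\sum_(m < D) (n%:R ^+ 2 : R[i])).
  apply: eq_bigr => m _; rewrite (bigD1 m) //= [X in _ + X]big1 => [|m' mm'].
    by rewrite addr0 zE eqxx mulr1 [_^*]conjc_nat expr2.
  by rewrite zE eq_sym (negPf mm') mulr0 mul0r.
by rewrite sumr_const card_ord -[_ *+ D]mulr_natl rmorphM rmorphXn /= !rmorph_nat.
Qed.

End dft.

(** * Inner products and finite orthonormal families *)

Lemma realnormZ {R : realType} {H : normedModType R[i]} (z : R[i]) (v : H) :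
  realnorm (z *: v) = cmod z * realnorm v.
Proof. by apply: complexI; rewrite rmorphM /= -cmodE -!realnormE normrZ. Qed.

Lemma realnorm_sum {R : realType} {H : normedModType R[i]} (I : Type)
    (r : seq I) (F : I -> H) :
  realnorm (\sum_(i <- r) F i) <= \sum_(i <- r) realnorm (F i).
Proof.
rewrite -lecR rmorph_sum /= -realnormE (le_trans (ler_norm_sum _ _ _))//.
by apply: ler_sum => i _; rewrite realnormE.
Qed.

Section hilbert.
Context {R : realType} {H : completeNormedModType R[i]}.
Variable dot : {dot H for @Num.conj R[i]}.
Hypothesis dotE : forall u : H, `|u| ^+ 2 = dot u u.
Implicit Types (u v w : H) (z : R[i]).

Lemma dotC u v : dot u v = (dot v u)^*.
Proof. by rewrite hermC expr0 mul1r. Qed.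

Lemma dotZr z u v : dot u (z *: v) = z^* * dot u v.
Proof. by rewrite linearZr_LR. Qed.

Lemma dotZl z u v : dot (z *: u) v = z * dot u v.
Proof. by rewrite linearZl_LR. Qed.

Lemma dotDl u v w : dot (u + v) w = dot u w + dot v w.
Proof. by rewrite linearDl. Qed.

Lemma dotDr u v w : dot w (u + v) = dot w u + dot w v.
Proof. by rewrite linearDr. Qed.

Lemma dot_sqr u : dot u u = (realnorm u ^+ 2)%:C.
Proof. by rewrite rmorphXn /= -realnormE dotE. Qed.

Lemma sqr_realnorm u : realnorm u ^+ 2 = complex.Re (dot u u).
Proof. by rewrite dot_sqr. Qed.

Lemma CauchySchwarz_dot u v : cmod (dot u v) <= realnorm u * realnorm v.
Proof.
have [->|v0] := eqVneq v 0.
  by rewrite linear0r realnorm0 mulr0 /cmod normr0.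
have nv : 0 < realnorm v by exact: realnorm_gt0.
set b := (realnorm v ^+ 2)%:C.
have : 0 <= realnorm (b *: u - dot u v *: v) ^+ 2 by rewrite sqr_ge0.
rewrite -ler0c -dot_sqr linearBl /= !linearBr /= !dotZl !dotZr (dot_sqr v) -/b.
rewrite (dotC v u) (dot_sqr u) [b^*]conjc_real -/b.
set a := dot u v; set c := (realnorm u ^+ 2)%:C.
have -> : b * (b * c) - b * (a^* * a) - (a * (b * a^*) - a * (a^* * b)) =
    b * (b * c - a * a^*) by ring.
rewrite -sqr_cmod /b /c -rmorphM -rmorphB -rmorphM ler0c.
rewrite pmulr_rge0 ?exprn_gt0// subr_ge0 -exprMn ler_pXn2r// ?nnegrE ?cmod_ge0//.
  by rewrite mulrC.
by rewrite mulr_ge0// ?realnorm_ge0.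
Qed.

Definition orthonormal_fam (A : finType) (e : A -> H) :=
  forall a b, dot (e a) (e b) = (a == b)%:R.

Section orthonormal_fam.
Context {A : finType} (e : A -> H).
Hypothesis oe : orthonormal_fam A e.

Lemma orthonormal_fam_dotl (c : A -> R[i]) a : dot (\sum_b c b *: e b) (e a) = c a.
Proof.
rewrite linear_sumlz (bigD1 a) //= dotZl oe eqxx mulr1 big1 ?addr0// => b ba.
by rewrite dotZl oe (negPf ba) mulr0.
Qed.

Lemma orthonormal_fam_dotr (c : A -> R[i]) u :
  dot u (\sum_a c a *: e a) = \sum_a (c a)^* * dot u (e a).
Proof. by rewrite linear_sumr /=; apply: eq_bigr => a _; rewrite dotZr. Qed.

Lemma orthonormal_fam_dot (c d : A -> R[i]) :
  dot (\sum_a c a *: e a) (\sum_a d a *: e a) = \sum_a c a * (d a)^*.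
Proof.
by rewrite orthonormal_fam_dotr; apply: eq_bigr => a _; rewrite orthonormal_fam_dotl mulrC.
Qed.

End orthonormal_fam.

Definition dot_isometry (Z : H -> H) := forall u v, dot (Z u) (Z v) = dot u v.

(** With w = f - e, the map u |-> u - <u,w>/<f,w> w is a unitary reflection.
Indeed <f,w> + <w,f> = <w,w> since f and e have the same norm, which is exactly
the condition for the rank one perturbation to preserve the inner product.  It
moves only the direction of w, hence fixes every u with <u,f> = <u,e>. *)
Lemma reflection (f e : H) : dot f f = dot e e ->
  exists Z : H -> H, [/\ linear Z, dot_isometry Z, Z f = e &
    forall u, dot u f = dot u e -> Z u = u].
Proof.
move=> fe; have [w wE] : exists w, w = f - e by exists (f - e).
pose a := (dot f w)^-1.
have zJ : dot f w + (dot f w)^* = dot w w.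
  rewrite -(dotC w f) wE !linearBl /= !linearBr /= -fe; ring.
exists (fun u => u - (a * dot u w) *: w); split.
- move=> c u v /=; rewrite linearDl /= dotZl (scalerBr c) scalerA.
  by rewrite [c * (a * _)]mulrCA mulrDr scalerDl opprD addrACA.
- move=> u v; rewrite !linearBl /= !linearBr /= !dotZl !dotZr. rewrite rmorphM /=.
  rewrite (dotC w v); set x := dot u w; set y := (dot v w)^*.
  have ax : (a^* + a = a * a^* * dot w w).
    (* If <f,w> = 0 then w = 0, and the formula gives the identity as 0^-1 = 0. *)
    have [z0|z0] := eqVneq (dot f w) 0.
      by rewrite /a z0 invr0 rmorph0 !mul0r addr0.
    have zz : (dot f w)^* != 0 by rewrite conjc_eq0.
    by rewrite -zJ /a fmorphV /=; field; rewrite z0 zz.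
  transitivity (dot u v - (a^* + a - a * a^* * dot w w) * x * y); first by ring.
  by rewrite ax; ring.
- have [z0|z0] := eqVneq (dot f w) 0; last by rewrite mulVf// scale1r wE opprB addrC subrK.
  have : dot w w == 0 by rewrite -zJ z0 rmorph0 addr0.
  rewrite dnorm_eq0 {1}wE subr_eq0 => /eqP fe1.
  by rewrite z0 mulr0 scale0r subr0.
- by move=> u ufe; rewrite wE linearBr /= ufe subrr mulr0 scale0r subr0.
Qed.

(** By induction on n: once the first n vectors are in place, the reflection
exchanging the image of f n with v n fixes the previous v i, because the
equality of Gram matrices says that both vectors have the same inner products
with them. *)
Lemma isometry_of_Gram (n : nat) (f v : nat -> H) :
  (forall i j, (i < n)%N -> (j < n)%N -> dot (f i) (f j) = dot (v i) (v j)) ->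
  exists Z : H -> H, [/\ linear Z, dot_isometry Z & forall i, (i < n)%N -> Z (f i) = v i].
Proof.
elim: n => [_|n IH Gr]; first by exists id; split.
have [|Z [Zl Zi Zf]] := IH.
  by move=> i j ni nj; apply: Gr; exact: ltnW.
have [|Y [Yl Yi Yf Yu]] := reflection (Z (f n)) (v n).
  by rewrite Zi Gr.
exists (Y \o Z); split=> /=.
- by move=> a x y /=; rewrite Zl Yl.
- by move=> x y /=; rewrite Yi Zi.
- move=> i; rewrite ltnS leq_eqVlt => /orP[/eqP->//|ni].
  by rewrite Zf// Yu// -{1}(Zf _ ni) Zi Gr// ltnW.
Qed.

(** Orthonormal systems indexed by an initial segment of nat, a form in which one
vector can be appended without changing the index type. *)
Definition orthonormal_below d (h : nat -> H) :=
  forall i j, (i < d)%N -> (j < d)%N -> dot (h i) (h j) = (i == j)%:R.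

Definition orthoproj d (h : nat -> H) v := \sum_(b < d) dot v (h b) *: h b.

Lemma dot_orthoproj d h v i : orthonormal_below d h -> (i < d)%N ->
  dot (orthoproj d h v) (h i) = dot v (h i).
Proof.
move=> oh id; have oh' : orthonormal_fam 'I_d (fun b => h b) by move=> a b; rewrite oh.
exact: (orthonormal_fam_dotl (fun b : 'I_d => h b) oh' (fun b => dot v (h b)) (Ordinal id)).
Qed.

Lemma orthonormal_below_extend d h v :
  orthonormal_below d h -> v != orthoproj d h v ->
  exists h', [/\ orthonormal_below d.+1 h', v = orthoproj d.+1 h' v &
    forall u, u = orthoproj d h u -> u = orthoproj d.+1 h' u].
Proof.
move=> oh vp; pose y := v - orthoproj d h v.
have y0 : realnorm y != 0.
  by apply: contra_neq vp => /realnorm_eq0/eqP; rewrite subr_eq0 => /eqP.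
have yh i : (i < d)%N -> dot y (h i) = 0.
  by move=> id; rewrite linearBl /= dot_orthoproj// subrr.
pose c := ((realnorm y)^-1)%:C; pose w := c *: y.
have wh i : (i < d)%N -> dot w (h i) = 0.
  by move=> id; rewrite dotZl yh// mulr0.
have hw i : (i < d)%N -> dot (h i) w = 0.
  by move=> id; rewrite dotC wh// rmorph0.
have ww : dot w w = 1.
  rewrite dotZl dotZr [c^*]conjc_real dot_sqr /c -!rmorphM /= expr2.
  by rewrite mulKf// mulVf.
pose h' i := if (i < d)%N then h i else w.
have h'E u : orthoproj d.+1 h' u = orthoproj d h u + dot u w *: w.
  rewrite /orthoproj big_ord_recr /= /h' ltnn; congr (_ + _).
  by apply: eq_bigr => i _; rewrite ltn_ord.
have pw u : dot (orthoproj d h u) w = 0.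
  by rewrite linear_sumlz big1//= => i _; rewrite dotZl hw// mulr0.
exists h'; split.
- move=> i j; rewrite !ltnS (leq_eqVlt i) (leq_eqVlt j) /h'.
  move=> /orP[/eqP->|id] /orP[/eqP->|jd].
  + by rewrite ltnn eqxx.
  + by rewrite ltnn jd wh// gtn_eqF.
  + by rewrite ltnn id hw// ltn_eqF.
  + by rewrite id jd oh.
- rewrite h'E -{1}[v](subrK (orthoproj d h v)) addrC -/y; congr (_ + _).
  have -> : dot v w = dot y w by rewrite /y linearBl /= pw subr0.
  rewrite dotZr [c^*]conjc_real dot_sqr scalerA /c -!rmorphM /= expr2.
  by rewrite mulKf// mulfV// scale1r.
- move=> u up; rewrite h'E -up up pw scale0r addr0 -up//.
Qed.

Lemma Gram_Schmidt (s : seq H) : exists d h, orthonormal_below d h /\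
  forall v, v \in s -> v = orthoproj d h v.
Proof.
elim: s => [|v s [d [h [oh hs]]]]; first by exists 0%N, (fun=> 0).
have [vp|vp] := eqVneq v (orthoproj d h v).
  by exists d, h; split=> // u; rewrite inE => /orP[/eqP->|/hs].
have [h' [oh' vh' uh']] := orthonormal_below_extend _ _ _ oh vp.
exists d.+1, h'; split => // u; rewrite inE => /orP[/eqP->//|/hs]; exact: uh'.
Qed.

Lemma orthonormal_below_exists d :
  infinite_dimensional H -> exists h, orthonormal_below d h.
Proof.
move=> Hinf; elim: d => [|d [h oh]]; first by exists (fun=> 0).
have [v vp] : exists v, v != orthoproj d h v.
  apply: contrapT => nv; apply: Hinf; exists d, (fun b => h b) => v.
  exists (fun b => dot v (h b)); apply: contrapT => /eqP vp.
  by apply: nv; exists v.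
by have [h' []] := orthonormal_below_extend _ _ _ oh vp; exists h'.
Qed.

End hilbert.

(** * Diagonal semigroups with a prescribed Gram function *)

Section diagonal.
Context {R : realType} {H : completeNormedModType R[i]}.
Variable dot : {dot H for @Num.conj R[i]}.
Hypothesis dotE : forall u : H, `|u| ^+ 2 = dot u u.
Context {A : finType} (e : A -> H) (th : A -> R).
Hypothesis oe : orthonormal_fam dot A e.
Implicit Types (t s : {nonneg R}) (u v : H).

(** The unitary group with eigenvectors e_a and frequencies th_a which is the
identity on the orthogonal complement, written as a finite rank perturbation of
the identity so that no projection on a complement has to be constructed. *)
Definition diag_act t v : H :=
  v + \sum_a ((cis (th a * t%:num) - 1) * dot v (e a)) *: e a.

Lemma diag_act_linear t : linear (diag_act t).
Proof.
move=> z u v; rewrite /diag_act scalerDr scaler_sumr addrACA -big_split /=.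
congr (_ + _); apply: eq_bigr => a _.
by rewrite (dotDl dot) (dotZl dot) scalerA mulrDr mulrCA scalerDl.
Qed.

Lemma diag_act_dot t v a :
  dot (diag_act t v) (e a) = cis (th a * t%:num) * dot v (e a).
Proof.
rewrite /diag_act (dotDl dot) (orthonormal_fam_dotl dot e oe
  (fun a => (cis (th a * t%:num) - 1) * dot v (e a))).
by ring.
Qed.

Lemma diag_act_isometry t v : `|diag_act t v| = `|v|.
Proof.
suff : dot (diag_act t v) (diag_act t v) = dot v v.
  rewrite !(dot_sqr dot dotE) => /complexI/eqP.
  by rewrite eqrXn2 ?realnorm_ge0// !realnormE => /eqP ->.
rewrite {2}/diag_act (dotDr dot) (orthonormal_fam_dotr dot e
  (fun a => (cis (th a * t%:num) - 1) * dot v (e a))).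
under eq_bigr do rewrite diag_act_dot.
rewrite /diag_act (dotDl dot) -addrA linear_sumlz -big_split big1 ?addr0//= => a _.
rewrite (dotZl dot) (dotC dot (e a)); set x := dot v (e a); set c := cis _.
rewrite !(rmorphM,rmorphB) /= rmorph1.
(* The contribution of each eigenvector cancels because |c| = 1. *)
transitivity (((c * c^*) - 1) * x * x^*); first by ring.
by rewrite cis_mulJ subrr !mul0r.
Qed.

Lemma diag_act0 v : diag_act 0%:nng v = v.
Proof.
rewrite /diag_act big1 ?addr0// => a _.
by rewrite /= mulr0 cis0 subrr mul0r scale0r.
Qed.

Lemma diag_actD s t v :
  diag_act (s%:num + t%:num)%:nng v = diag_act s (diag_act t v).
Proof.
rewrite {2}/diag_act; under [in RHS]eq_bigr do rewrite diag_act_dot.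
rewrite /diag_act -addrA -big_split /=; congr (_ + _); apply: eq_bigr => a _.
by rewrite -scalerDl mulrDr cisD; congr (_ *: _); ring.
Qed.

(** The orbits are Lipschitz: |e^{ia} - e^{ib}| <= |a - b|. *)
Lemma diag_act_continuous v :
  {within `[0, +oo[, continuous (fun t : R => diag_act (nngabs t) v)}.
Proof.
apply: continuous_subspaceT => t0; apply/cvgrPdist_le => _ /posC[r r0 ->].
pose K := \sum_a (`|th a| * cmod (dot v (e a)) * realnorm (e a)).
have K0 : 0 <= K.
  by apply: sumr_ge0 => a _; rewrite !mulr_ge0 ?cmod_ge0 ?realnorm_ge0.
have K1 : 0 < K + 1 by rewrite ltr_wpDl.
near=> t; rewrite realnormE lecR.
have tt0 : `|t0 - t| <= r / (K + 1).
  near: t; have /cvgrPdist_le : id @ nbhs t0 --> t0 by exact: cvg_id.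
  by apply; rewrite divr_gt0.
rewrite /diag_act opprD addrACA subrr add0r -sumrB (le_trans (realnorm_sum _ _ _))//.
apply: (@le_trans _ _ (K * `|t0 - t|)).
  rewrite mulr_suml; apply: ler_sum => a _.
  rewrite -scalerBl -mulrBl realnormZ cmodM [leRHS]mulrAC ler_wpM2r ?realnorm_ge0//.
  rewrite [leRHS]mulrAC ler_wpM2r ?cmod_ge0// opprB addrA subrK.
  rewrite (le_trans (cmod_cisB_le _ _))// -mulrBr normrM ler_wpM2l//.
  exact: ler_dist_dist.
rewrite (le_trans (ler_wpM2l K0 tt0))// mulrCA ler_piMr ?(ltW r0)//.
by rewrite ler_pdivrMr// mul1r lerDl.
Unshelve. all: by end_near. Qed.

Definition diag_sg : isoC0semigroup H :=
  IsoC0Semigroup diag_act_linear diag_act_isometry diag_act0 diag_actD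
    diag_act_continuous.

Lemma diag_sgE t (x : A -> R[i]) :
  diag_sg t (\sum_a x a *: e a) = \sum_a (cis (th a * t%:num) * x a) *: e a.
Proof.
rewrite /= /diag_act; under [X in _ + X]eq_bigr do rewrite (orthonormal_fam_dotl dot e oe x).
rewrite -big_split /=; apply: eq_bigr => a _; rewrite -scalerDl; congr (_ *: _).
by ring.
Qed.

Lemma diag_sg_id t v : (forall a, cis (th a * t%:num) = 1) -> diag_sg t v = v.
Proof.
move=> h; rewrite /= /diag_act big1 ?addr0// => a _.
by rewrite h subrr mul0r scale0r.
Qed.

End diagonal.

Section semigroup_of_Gram_nat.
Context {R : realType} {H : completeNormedModType R[i]}.
Variable dot : {dot H for @Num.conj R[i]}.
Hypothesis dotE : forall u : H, `|u| ^+ 2 = dot u u.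

(** The vectors c_a i play the role of the component of v_i of frequency th_a in
some large space, where they would be mutually orthogonal for distinct a.  They
are first written in coordinates in an orthonormal basis h of their common span,
and the components of distinct frequencies are then separated by giving each
frequency its own copy of this basis inside H.  The sum f_i of the copies has
the same Gram matrix as v_i, so a linear isometry carries it to v_i, and carries
the orthonormal copies to the eigenvectors of the required semigroup. *)
Lemma semigroup_of_Gram_nat (A : finType) (th : A -> R) (n : nat) (v : nat -> H)
    (c : A -> nat -> H) : infinite_dimensional H ->
  (forall i j, (i < n)%N -> (j < n)%N ->
     \sum_a dot (c a i) (c a j) = dot (v i) (v j)) ->
  exists S : isoC0semigroup H,
    (forall i j (t s : {nonneg R}), (i < n)%N -> (j < n)%N ->
      dot (S t (v i)) (S s (v j)) =
      \sum_a cis (th a * (t%:num - s%:num)) * dot (c a i) (c a j)) /\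
    (forall t w, (forall a, cis (th a * t%:num) = 1) -> S t w = w).
Proof.
move=> Hinf Gr.
have [d [h [oh hc]]] := Gram_Schmidt dot dotE
  [seq c a i | a <- enum A, i <- iota 0 n].
have {}hc a i : (i < n)%N -> c a i = orthoproj dot d h (c a i).
  by move=> ni; apply: hc; apply: allpairs_f; rewrite ?mem_enum// mem_iota.
pose P := (A * 'I_d)%type.
have [g og] := orthonormal_below_exists dot dotE #|{: P}| Hinf.
pose g' (p : P) := g (enum_rank p).
have og' : orthonormal_fam dot _ g'.
  by move=> p q; rewrite og ?ltn_ord// (inj_eq val_inj) (inj_eq enum_rank_inj).
(* x i is the coordinate vector of v_i along the family indexed by P. *)
pose x i (p : P) := dot (c p.1 i) (h p.2).
have xx i j (y : A -> R[i]) : (i < n)%N -> (j < n)%N ->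
    \sum_p y p.1 * (x i p * (x j p)^*) = \sum_a y a * dot (c a i) (c a j).
  move=> ni nj.
  rewrite -(pair_bigA _ (fun a b => y a * (x i (a, b) * (x j (a, b))^*))) /=.
  apply: eq_bigr => a _; rewrite -mulr_sumr; congr (_ * _).
  rewrite [in RHS](hc _ _ ni) [in RHS](hc _ _ nj) /orthoproj.
  by rewrite (@orthonormal_fam_dot _ _ _ 'I_d (fun b => h b))// => b b'; rewrite oh.
have [|Z [Zl Zi Zf]] := isometry_of_Gram dot n (fun i => \sum_p x i p *: g' p) v.
  move=> i j ni nj; rewrite orthonormal_fam_dot// -Gr//.
  have := xx i j (fun=> 1) ni nj.
  by under eq_bigr do rewrite mul1r; under [in RHS]eq_bigr do rewrite mul1r.
pose Zlin : {linear H -> H} := HB.pack Z (GRing.isLinear.Build _ _ _ _ Z Zl).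
pose e p := Z (g' p).
have oe : orthonormal_fam dot _ e by move=> p q; rewrite Zi og'.
have vE i : (i < n)%N -> v i = \sum_p x i p *: e p.
  move=> ni; rewrite -Zf//; have := linear_sum Zlin => /= ->.
  by apply: eq_bigr => p _; have := linearZZ Zlin => /= ->.
exists (diag_sg dot dotE e (fun p => th p.1) oe); split; last first.
  by move=> t w h1; apply: diag_sg_id => p.
move=> i j t s ni nj; rewrite (vE _ ni) (vE _ nj) !diag_sgE orthonormal_fam_dot//.
rewrite -(xx _ _ (fun a => cis (th a * (t%:num - s%:num))) ni nj).
apply: eq_bigr => p _.
by rewrite rmorphM /= mulrBr cisB; ring.
Qed.

End semigroup_of_Gram_nat.


Section semigroup_of_Gram.
Context {R : realType} {H : completeNormedModType R[i]}.
Variable dot : {dot H for @Num.conj R[i]}.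
Hypothesis dotE : forall u : H, `|u| ^+ 2 = dot u u.

Lemma sqr_realnormB (u v : H) : (realnorm (u - v) ^+ 2)%:C =
  dot u u - dot u v - (dot v u - dot v v).
Proof. by rewrite -(dot_sqr dot dotE) linearBl /= !linearBr. Qed.

(** The same realization for families indexed by a finite type, together with the
distances between orbit points, which can be computed frequency by frequency. *)
Lemma semigroup_of_Gram (A I : finType) (th : A -> R) (v : I -> H)
    (c : A -> I -> H) : infinite_dimensional H ->
  (forall i j, \sum_a dot (c a i) (c a j) = dot (v i) (v j)) ->
  exists S : isoC0semigroup H,
    [/\ forall i j (t s : {nonneg R}), dot (S t (v i)) (S s (v j)) =
      \sum_a cis (th a * (t%:num - s%:num)) * dot (c a i) (c a j),
      forall i j (t s : {nonneg R}), realnorm (S t (v i) - S s (v j)) ^+ 2 =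
      \sum_a realnorm (cis (th a * t%:num) *: c a i -
                       cis (th a * s%:num) *: c a j) ^+ 2 &
    forall t w, (forall a, cis (th a * t%:num) = 1) -> S t w = w].
Proof.
move=> Hinf Gr.
pose ext (f : I -> H) k := if insub k is Some o then f (enum_val (o : 'I_#|I|)) else 0.
have extE f i : ext f (enum_rank i) = f i.
  by rewrite /ext valK enum_rankK.
have [|S [SG Sid]] := semigroup_of_Gram_nat dot dotE A th #|I| (ext v) (fun a => ext (c a)) Hinf.
  move=> i j ni nj; pose i' := enum_val (Ordinal ni); pose j' := enum_val (Ordinal nj).
  have ii : i = enum_rank i' by rewrite enum_valK.
  have jj : j = enum_rank j' by rewrite enum_valK.
  rewrite ii jj !extE -Gr; apply: eq_bigr => a _; by rewrite !extE.
have SD i j (t s : {nonneg R}) : dot (S t (v i)) (S s (v j)) =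
      \sum_a cis (th a * (t%:num - s%:num)) * dot (c a i) (c a j).
  rewrite -(extE v i) -(extE v j) SG//.
  by apply: eq_bigr => a _; rewrite !extE.
exists S; split=> // i j t s; apply: complexI.
rewrite sqr_realnormB !SD rmorph_sum /= -!sumrB; apply: eq_bigr => a _.
rewrite sqr_realnormB !(dotZl dot) !(dotZr dot) !mulrBr !cisB; ring.
Qed.

End semigroup_of_Gram.

(** * Semigroups at real times *)

Section sgtime.
Context {R : realType} {H : completeNormedModType R[i]}.
Implicit Types (T : isoC0semigroup H).

Lemma nngabsE (t : {nonneg R}) : nngabs t%:num = t.
Proof. by apply/val_inj => /=; rewrite ger0_norm. Qed.

Lemma nngabs_num (t : R) : 0 <= t -> (nngabs t)%:num = t.
Proof. by move=> t0; rewrite /= ger0_norm. Qed.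

Lemma sg_nngabsD T (s t : R) v : 0 <= s -> 0 <= t ->
  T (nngabs (s + t)) v = T (nngabs s) (T (nngabs t) v).
Proof.
move=> s0 t0; rewrite -sgD; congr (T _ v); apply/val_inj => /=.
by rewrite !ger0_norm// addr_ge0.
Qed.

Lemma sg_nngabs0 T v : T (nngabs 0) v = v.
Proof.
by rewrite -[RHS](sg0 T); congr (T _ v); apply/val_inj => /=; rewrite normr0.
Qed.

Lemma sg_iter T (h : R) l v : 0 <= h ->
  T (nngabs (l%:R * h)) v = iter l (T (nngabs h)) v.
Proof.
move=> h0; elim: l => [|l IH] /=.
  by rewrite mul0r sg_nngabs0.
by rewrite -add1n natrD mulrDl mul1r sg_nngabsD ?IH// mulr_ge0.
Qed.

(** Strong continuity at time 0, uniformly over finitely many vectors, with a step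
of the form 1/(M+1) so that integer times are multiples of it. *)
Lemma sg_small T (J : nat) (x : nat -> H) (eta : R) : 0 < eta ->
  exists M : nat, forall j (s : {nonneg R}), (j < J)%N ->
    s%:num <= M.+1%:R^-1 -> realnorm (T s (x j) - x j) <= eta.
Proof.
move=> eta0; have etaC : 0 < eta%:C by rewrite ltcR.
elim: J => [|J [M IH]]; first by exists 0%N.
have /subspace_continuousP/(_ 0) := @sg_continuous _ _ T (x J).
rewrite /= in_itv /= lexx => /(_ isT)/cvgrPdist_le/(_ _ etaC).
rewrite /within /= -nbhs_nearE => -[r /= r0 hr].
pose K := Num.truncn r^-1; exists (maxn M K) => j s.
have Mi M1 : (M1 <= maxn M K)%N -> (maxn M K).+1%:R^-1 <= M1.+1%:R^-1 :> R.
  by move=> MM; rewrite lef_pV2 ?posrE// ler_nat.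
rewrite ltnS leq_eqVlt => /orP[/eqP-> sM|jJ sM]; last first.
  by apply: IH => //; rewrite (le_trans sM)// Mi// leq_maxl.
have := hr s%:num; rewrite /ball /= sub0r normrN ger0_norm//.
have sr : s%:num < r.
  rewrite (le_lt_trans sM)// (le_lt_trans (Mi K (leq_maxr _ _)))//.
  by rewrite invf_plt ?posrE// truncnS_gt.
move=> /(_ sr); rewrite in_itv /= andbT => /(_ (ge0 s)).
by rewrite /from_subspace sg_nngabs0 nngabsE realnormE lecR realnormB.
Unshelve. all: by end_near. Qed.

End sgtime.

(** * Fourier coefficients of an isometry *)

(** A vector u is represented by the samples V^m u for m < q, seen as a function on
the cyclic group of order q = 2p + 1, and fourier_coef k u is its k-th Fourier
coefficient.  The frequencies are centred, from -p to p, so that they stay below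
half a turn in absolute value. *)
Section fourier.
Context {R : realType} {H : completeNormedModType R[i]}.
Variable dot : {dot H for @Num.conj R[i]}.
Hypothesis dotE : forall u : H, `|u| ^+ 2 = dot u u.
Variable V : H -> H.
Hypothesis Viso : dot_isometry dot V.
Variable p : nat.
Implicit Types (u w : H).

Let q := p.*2.+1.

Definition freq (k : nat) : R := pi *+ 2 / q%:R * (k%:R - p%:R).

Definition fourier_coef (k : nat) u : H :=
  q%:R^-1 *: \sum_(m < q) (cis (freq k * m%:R))^* *: iter m V u.

Lemma dot_isometry_iter m : dot_isometry dot (iter m V).
Proof. by elim: m => [//|m IH] u w /=; rewrite Viso IH. Qed.

Lemma dot_isometry_norm (Z : H -> H) u : dot_isometry dot Z ->
  realnorm (Z u) = realnorm u.
Proof.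
move=> Zi; have := congr1 (fun z => complex.Re z) (Zi u u).
rewrite -!(sqr_realnorm dot dotE) => /eqP.
by rewrite eqrXn2 ?realnorm_ge0// => /eqP.
Qed.

(** Every centred frequency is a multiple of 2 pi / q. *)
Lemma cis_freq k n : cis (freq k * (q%:R * n%:R)) = 1.
Proof.
have -> : freq k * (q%:R * n%:R) = pi *+ 2 * (k * n)%:R - pi *+ 2 * (p * n)%:R.
  have q0 : q%:R != 0 :> R by rewrite pnatr_eq0.
  by rewrite /freq !natrM; field.
by rewrite cisB !cis_2pin mul1r; exact: conjc1.
Qed.

Lemma freq_le k : (k < q)%N -> `|freq k| <= pi *+ 2 / q%:R * p%:R.
Proof.
move=> kq; have pi2 : 0 <= pi *+ 2 / q%:R :> R.
  by rewrite divr_ge0// mulrn_wge0// pi_ge0.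
rewrite /freq normrM (ger0_norm pi2) ler_wpM2l// ler_distl.
rewrite -subr_ge0 opprB; apply/andP; split.
  by rewrite subrr.
by rewrite -natrD ler_nat addnn -ltnS.
Qed.

(** Parseval: by the orthogonality of characters only the products of V^m u and
V^m w with the same m remain, and V is an isometry. *)
Lemma fourier_coef_Gram u w :
  \sum_(k < q) dot (fourier_coef k u) (fourier_coef k w) = dot u w.
Proof.
have q0 : q%:R != 0 :> R[i] by rewrite pnatr_eq0.
have E k : dot (fourier_coef k u) (fourier_coef k w) = q%:R^-1 ^+ 2 *
    \sum_(m < q) \sum_(m' < q) dot (iter m V u) (iter m' V w) *
    (cis (pi *+ 2 / q%:R * (m'%:R - m%:R) * k%:R) *
     (cis (pi *+ 2 / q%:R * (m'%:R - m%:R) * p%:R))^*).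
  rewrite /fourier_coef dotZl dotZr fmorphV rmorph_nat mulrA -expr2; congr (_ * _).
  rewrite linear_sumlz /=; apply: eq_bigr => m _.
  rewrite dotZl linear_sumr mulr_sumr /=; apply: eq_bigr => m' _.
  rewrite dotZr [((cis _)^* )^*]conjcK mulrA mulrC; congr (_ * _).
  by rewrite -cisB mulrC -cisB; congr cis; rewrite /freq; ring.
under eq_bigr do rewrite E.
rewrite -mulr_sumr exchange_big /=.
transitivity (q%:R^-1 ^+ 2 * (\sum_(m < q) q%:R * dot u w)); last first.
  rewrite sumr_const card_ord -[(_ * _) *+ _]mulr_natl; field; exact: q0.
congr (_ * _); apply: eq_bigr => m _; rewrite exchange_big /=.
rewrite (bigD1 m) //= [X in _ + X]big1 ?addr0.
  rewrite -mulr_sumr -mulr_suml dft_orth// subrr mulr0 mul0r.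
  by rewrite -cisN oppr0 cis0 eqxx !mulr1 dot_isometry_iter mulrC.
move=> m' mm'; rewrite -mulr_sumr -mulr_suml dft_orth//.
by rewrite (inj_eq val_inj) (negPf mm') mulr0 mul0r mulr0.
Qed.

(** The cyclic shift of the samples differs from the shift by V only where the
index wraps around: the sum telescopes to the terms with m = 0 and m = q. *)
Lemma fourier_coef_shift k u :
  cis (freq k) *: fourier_coef k u - fourier_coef k (V u) =
  (cis (freq k) * q%:R^-1) *: (u - iter q V u).
Proof.
pose g m := (cis (freq k * m%:R))^* *: iter m V u.
have gS m : (cis (freq k * m%:R))^* *: iter m V (V u) = cis (freq k) *: g m.+1.
  rewrite /g scalerA -iterSr; congr (_ *: _).
  rewrite -natr1 mulrDr mulr1 cisD rmorphM /= mulrCA mulrC.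
  by rewrite cis_mulJ mulr1.
rewrite /fourier_coef; under [X in _ - _ *: X]eq_bigr do rewrite gS.
rewrite -scaler_sumr !scalerA [_ * cis _]mulrC -scalerBr; congr (_ *: _).
rewrite -(big_mkord xpredT g) -(big_mkord xpredT (fun m => g m.+1)) -sumrB.
under eq_bigr do rewrite -opprB.
rewrite sumrN telescope_sumr// opprB /g mulr0 -cisN oppr0 cis0 scale1r.
have cq : cis (- (freq k * q%:R)) = 1.
  by rewrite cisN -[q%:R]mulr1 (cis_freq k 1); exact: conjc1.
by rewrite -cisN cq scale1r.
Qed.

End fourier.

(** * Periodic approximation of isometric semigroups *)

Section core.
Context {R : realType} {H : completeNormedModType R[i]}.
Variable dot : {dot H for @Num.conj R[i]}.
Hypothesis dotE : forall u : H, `|u| ^+ 2 = dot u u.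
Hypothesis Hinf : infinite_dimensional H.

(** The squared Hilbert-Schmidt norm of the Gram matrix of u, S(1)u, ..., S(n-1)u.
Divided by n^2 it is small when the orbit of u spreads over many directions. *)
Definition gram_energy (S : isoC0semigroup H) (u : H) (n : nat) : R :=
  \sum_(r < n) \sum_(s < n)
    cmod (dot (S (nngabs r%:R) u) (S (nngabs s%:R) u)) ^+ 2.

(** By polarization. *)
Lemma sg_dot_isometry (S : isoC0semigroup H) t : dot_isometry dot (S t).
Proof.
have N v : dot (S t v) (S t v) = dot v v by rewrite -!dotE sg_isometry.
have lin := sg_linear S t.
have D u v : S t (u + v) = S t u + S t v by have := lin 1 u v; rewrite !scale1r.
have S0 : S t 0 = 0 by have := sgB S t 0 0; rewrite !subrr.
have Z z v : S t (z *: v) = z *: S t v by have := lin z v 0; rewrite S0 !addr0.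
move=> u v.
have P w : dot (S t u) (S t w) + dot (S t w) (S t u) = dot u w + dot w u.
  have := N (u + w); rewrite D !(dotDl dot) !(dotDr dot) !N => e.
  have -> : dot u w + dot w u =
      dot u u + dot u w + (dot w u + dot w w) - dot u u - dot w w by ring.
  by rewrite -e; ring.
pose I : R[i] := 0 +i* 1.
have := P (I *: v); have := P v; rewrite Z !(dotZl dot) !(dotZr dot).
rewrite (dotC dot (S t v)) (dotC dot v u).
case: (dot (S t u) (S t v)) => a b; case: (dot u v) => c d.
move=> /(congr1 (fun z => complex.Re z)) /= e1.
move=> /(congr1 (fun z => complex.Re z)) /= e2.
apply/eqP; rewrite eq_complex /=.
apply/andP; split; apply/eqP; lra.
Qed.

(** The frequencies of the approximating semigroup are indexed by pairs (k, m): the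
k-th Fourier frequency, rescaled to the time step h, is split into D frequencies
at distance delta, each of which receives the fraction 1/D of the squared norm.
The choice of n makes the D frequencies exactly orthogonal over the integer times
below n, and makes the total deviation delta * D less than 1/q.  The second
component of I goes up to L + 1, to include the images under V of the first L + 1
samples. *)
Section construction.
Variables (T : isoC0semigroup H) (M p D L J : nat) (x : nat -> H).
Hypothesis D0 : (0 < D)%N.

Let h : R := M.+1%:R^-1.
Let V := T (nngabs h).
Let q := p.*2.+1.
Let n := (8 * q * D)%N.
Let delta : R := pi *+ 2 / n%:R.
Let A := ('I_q * 'I_D)%type.
Let I := ('I_J * 'I_L.+2)%type.
Let th (a : A) : R := freq p a.1 * M.+1%:R + delta * a.2%:R.
Let sc : R := (Num.sqrt D%:R)^-1.
Let v (i : I) := iter i.2 V (x i.1).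
Let c (a : A) (i : I) := sc%:C *: fourier_coef V p a.1 (v i).

Let h0 : 0 < h. Proof. by rewrite invr_gt0 ltr0n. Qed.
Let q0 : 0 < q%:R :> R. Proof. by rewrite ltr0n. Qed.
Let D0r : 0 < D%:R :> R. Proof. by rewrite ltr0n. Qed.
Let n0 : 0 < n%:R :> R. Proof. by rewrite ltr0n !muln_gt0 D0. Qed.
Let Viso : dot_isometry dot V. Proof. exact: sg_dot_isometry. Qed.
Let vx i : realnorm (v i) = realnorm (x i.1).
Proof. by rewrite (dot_isometry_norm dot dotE)//; exact: dot_isometry_iter. Qed.
Let sc2 : sc ^+ 2 = D%:R^-1.
Proof. by rewrite /sc exprVn sqr_sqrtr// ler0n. Qed.

Let c_dot a i j : dot (c a i) (c a j) =
  (D%:R^-1)%:C * dot (fourier_coef V p a.1 (v i)) (fourier_coef V p a.1 (v j)).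
Proof.
by rewrite (dotZl dot) (dotZr dot) mulrA [(sc%:C)^*]conjc_real -rmorphM -expr2 sc2.
Qed.

Let sum_fourier_coef u :
  \sum_(k < q) realnorm (fourier_coef V p k u) ^+ 2 = realnorm u ^+ 2.
Proof.
apply: complexI; rewrite rmorph_sum /= -(dot_sqr dot dotE) -(fourier_coef_Gram dot V Viso p).
by apply: eq_bigr => k _; rewrite (dot_sqr dot dotE).
Qed.

Let Gr i j : \sum_a dot (c a i) (c a j) = dot (v i) (v j).
Proof.
under eq_bigr do rewrite c_dot.
rewrite -mulr_sumr.
rewrite -(pair_bigA _ (fun (k : 'I_q) (_ : 'I_D) =>
  dot (fourier_coef V p k (v i)) (fourier_coef V p k (v j)))) /=.
under eq_bigr do rewrite sumr_const card_ord -[_ *+ D]mulr_natl.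
rewrite -mulr_sumr fourier_coef_Gram// mulrA fmorphV /= rmorph_nat mulVf ?mul1r//.
by rewrite pnatr_eq0 -lt0n.
Qed.

Let delta0 : 0 <= delta.
Proof. by rewrite divr_ge0// mulrn_wge0// pi_ge0. Qed.

Let deltaD : delta * D%:R <= q%:R^-1.
Proof.
have -> : delta * D%:R = pi / 4 * q%:R^-1.
  rewrite /delta /n !natrM -[pi *+ 2]mulr_natr; field.
  by rewrite !gt_eqF.
rewrite ler_piMl ?invr_ge0 ?(ltW q0)//; have := pihalf_lt2 R; lra.
Qed.

Let shift_h (a : A) : `|delta * a.2%:R * h| <= q%:R^-1.
Proof.
have h1 : h <= 1 by rewrite invf_le1 ?ltr0n// ler1n.
have da : 0 <= delta * a.2%:R by rewrite mulr_ge0.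
rewrite ger0_norm; last by rewrite mulr_ge0// ltW.
rewrite (le_trans _ deltaD)// -[leRHS]mulr1; apply: ler_pM => //.
  exact: ltW.
by rewrite ler_wpM2l// ler_nat ltnW.
Qed.

(** The room of pi / q between the largest centred frequency and half a turn
accommodates the splitting of the frequencies. *)
Let th_h a : `|th a * h| <= pi.
Proof.
have -> : th a * h = freq p a.1 + delta * a.2%:R * h.
  by rewrite mulrDl mulfK// pnatr_eq0.
rewrite (le_trans (ler_normD _ _))//.
rewrite (le_trans (lerD (freq_le p a.1 (ltn_ord _)) (shift_h a)))// -/q.
have piE : pi = pi *+ 2 / q%:R * p%:R + pi / q%:R :> R.
  have qE : q%:R = p%:R * 2 + 1 :> R by rewrite /q -natr1 -muln2 natrM.
  have pE : p%:R = (q%:R - 1) / 2 :> R by rewrite qE; field.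
  rewrite pE -[pi *+ 2]mulr_natr; field; exact: lt0r_neq0.
rewrite [leRHS]piE lerD2l -[leLHS]mul1r ler_wpM2r ?invr_ge0 ?(ltW q0)//.
by have := pi_ge2 R; lra.
Qed.


(** The two sources of error: the displacement of the frequencies, at most 1/q for
each of them, and the wrap-around term of fourier_coef_shift, of size 2X/q in
each of the q coordinates. *)
Let step i j : v j = V (v i) ->
  \sum_a realnorm (cis (th a * h) *: c a i - c a j) ^+ 2 <=
    10 * realnorm (v i) ^+ 2 / q%:R.
Proof.
move=> vj; set X := realnorm (v i).
have X0 : 0 <= X by exact: realnorm_ge0.
have qi : 0 <= q%:R^-1 :> R by rewrite invr_ge0 ltW.
have qi1 : q%:R^-1 <= 1 :> R by rewrite invf_le1// ler1n.
have bd (a : A) : realnorm (cis (th a * h) *: c a i - c a j) ^+ 2 <=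
    D%:R^-1 * (2 * (q%:R^-1 ^+ 2 * realnorm (fourier_coef V p a.1 (v i)) ^+ 2 +
                   (2 * X / q%:R) ^+ 2)).
  set k := nat_of_ord a.1; set f := fourier_coef V p k (v i).
  have -> : cis (th a * h) *: c a i - c a j = sc%:C *:
      ((cis (delta * a.2%:R * h) - 1) *: (cis (freq p k) *: f) +
       (cis (freq p k) *: f - fourier_coef V p k (V (v i)))).
    rewrite /c -vj -/k -/f scalerBl scale1r addrA subrK scalerBr; congr (_ - _).
    rewrite !scalerA; congr (_ *: _).
    rewrite mulrDl mulfK ?pnatr_eq0// -/k addrC cisD; ring.
  rewrite realnormZ exprMn cmod_real real_normK ?num_real// sc2.
  rewrite ler_wpM2l ?invr_ge0 ?ler0n// fourier_coef_shift//.
  set A1 := (_ *: (_ *: f)); set A2 := (_ *: (_ - _)).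
  have n1 : realnorm A1 <= q%:R^-1 * realnorm f.
    rewrite realnormZ realnormZ cmod_cis mul1r ler_wpM2r ?realnorm_ge0//.
    exact: le_trans (cmod_cisB1_le _) (shift_h a).
  have n2 : realnorm A2 <= 2 * X / q%:R.
    rewrite realnormZ cmodM cmod_cis mul1r -(rmorph_nat (real_complex R)) -fmorphV cmod_real.
    rewrite ger0_norm// mulrC ler_wpM2r//.
    rewrite (le_trans (realnorm_distD 0 _ _))// subr0 sub0r.
    rewrite {2}/realnorm normrN -/(realnorm _).
    rewrite (dot_isometry_norm dot dotE _ (v i) (dot_isometry_iter dot V Viso _)).
    by rewrite -/X; lra.
  have := realnormD A1 A2; have := realnorm_ge0 (A1 + A2); have := realnorm_ge0 f.
  move=> f0 r0 rD.
  have rr : realnorm (A1 + A2) <= q%:R^-1 * realnorm f + 2 * X / q%:R.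
    exact: le_trans rD (lerD n1 n2).
  have : realnorm (A1 + A2) ^+ 2 <= (q%:R^-1 * realnorm f + 2 * X / q%:R) ^+ 2.
    by rewrite ler_pXn2r// nnegrE// (le_trans r0).
  move/le_trans; apply.
  rewrite -exprMn; set y1 := _ * _; set y2 := _ / _.
  have := sqr_ge0 (y1 - y2); nra.
rewrite (le_trans (ler_sum _ (fun a _ => bd a)))//.
rewrite -(pair_bigA _ (fun (k : 'I_q) (_ : 'I_D) => D%:R^-1 *
  (2 * (q%:R^-1 ^+ 2 * realnorm (fourier_coef V p k (v i)) ^+ 2 +
        (2 * X / q%:R) ^+ 2)))) /=.
under eq_bigr do rewrite sumr_const card_ord -[_ *+ D]mulr_natl mulVKf ?gt_eqF//.
rewrite -mulr_sumr big_split /= -mulr_sumr sum_fourier_coef -/X sumr_const card_ord.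
rewrite -[(_ ^+ 2) *+ q]mulr_natl.
have -> : 2 * (q%:R^-1 ^+ 2 * X ^+ 2 + q%:R * (2 * X / q%:R) ^+ 2) =
    (2 * q%:R^-1 + 8) * X ^+ 2 / q%:R :> R.
  by field; exact: lt0r_neq0.
by rewrite ler_wpM2r// ler_wpM2r ?sqr_ge0//; lra.
Qed.

(** The four clauses say that one step of S is close to one step of T along the
samples, that S moves the samples less before time h than at time h, that S is
periodic, and that S spreads the vectors x_j.  In the third one, q * n is a
period because all frequencies are integer multiples of 2 pi / (q * n). *)
Lemma periodic_interpolation : exists S : isoC0semigroup H, [/\
  forall j l, (j < J)%N -> (l <= L)%N ->
    realnorm (S (nngabs h) (iter l V (x j)) - iter l.+1 V (x j)) ^+ 2 <=
      10 * realnorm (x j) ^+ 2 / q%:R,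
  forall j l (t : {nonneg R}), (j < J)%N -> (l <= L)%N -> t%:num <= h ->
    realnorm (S t (iter l V (x j)) - iter l V (x j)) <=
    realnorm (S (nngabs h) (iter l V (x j)) - iter l V (x j)),
  forall (r : nat) w, S (nngabs (q * n * r)%N%:R) w = w &
  forall j, (j < J)%N ->
    gram_energy S (x j) n <= n%:R ^+ 2 * realnorm (x j) ^+ 4 / D%:R].
Proof.
have [S [Sdot Sdist Sid]] := semigroup_of_Gram dot dotE A I th v c Hinf Gr.
have numh : (nngabs h)%:num = h by rewrite nngabs_num// ltW.
exists S; split.
- move=> j l jJ lL.
  pose i : I := (Ordinal jJ, Ordinal (leqW lL : (l < L.+2)%N)).
  pose i' : I := (Ordinal jJ, Ordinal (lL : (l.+1 < L.+2)%N)).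
  have := Sdist i i' (nngabs h) (nngabs 0); rewrite sg_nngabs0 numh nngabs_num// /v /= => ->.
  rewrite -(vx i); apply: le_trans (step i i' erefl).
  by apply: ler_sum => a _; rewrite mulr0 cis0 scale1r.
- move=> j l t jJ lL th'.
  pose i : I := (Ordinal jJ, Ordinal (leqW lL : (l < L.+2)%N)).
  rewrite -(@ler_pXn2r _ 2) ?nnegrE ?realnorm_ge0//.
  have := Sdist i i (nngabs h) (nngabs 0); have := Sdist i i t (nngabs 0).
  rewrite sg_nngabs0 numh nngabs_num// /v => /= -> ->; apply: ler_sum => a _.
  rewrite mulr0 cis0 -!scalerBl !(realnormZ (_ - _)) !exprMn.
  rewrite ler_wpM2r ?sqr_ge0//.
  rewrite ler_pXn2r ?nnegrE ?cmod_ge0// cmod_cisB1_homo// !normrM.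
  by rewrite ler_wpM2l// !ger0_norm// ltW.
- move=> r w; apply: Sid => a; rewrite nngabs_num// /th mulrDl cisD.
  have -> : freq p a.1 * M.+1%:R * (q * n * r)%N%:R =
     freq p a.1 * (q%:R * (M.+1 * n * r)%N%:R) :> R.
    by rewrite !natrM; ring.
  rewrite cis_freq mul1r.
  have -> : delta * a.2%:R * (q * n * r)%N%:R =
      pi *+ 2 * (a.2 * q * r)%N%:R.
    have dn : delta * n%:R = pi *+ 2 by rewrite /delta divfK// lt0r_neq0.
    rewrite (mulnC q n) -(mulnA n q r) -(mulnA _ q r) (natrM _ n) (natrM _ a.2).
    by rewrite mulrACA dn.
  exact: cis_2pin.
- move=> j jJ; pose i : I := (Ordinal jJ, ord0).
  have vi : v i = x j by [].
  set X := realnorm (x j).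
  have bd (r s : 'I_n) : cmod (dot (S (nngabs r%:R) (x j)) (S (nngabs s%:R) (x j))) ^+ 2 <=
      X ^+ 4 / D%:R ^+ 2 *
      cmod (\sum_(m < D) cis (pi *+ 2 / n%:R * m%:R * (r%:R - s%:R))) ^+ 2.
    rewrite -vi Sdot !nngabs_num//; under eq_bigr do rewrite c_dot (dot_sqr dot dotE).
    rewrite -/delta; set G := \sum_(m < D) _.
    have -> : \sum_a cis (th a * (r%:R - s%:R)) *
        ((D%:R^-1)%:C * (realnorm (fourier_coef V p a.1 (v i)) ^+ 2)%:C) =
        (D%:R^-1)%:C * ((\sum_(k < q) cis (freq p k * M.+1%:R * (r%:R - s%:R)) *
           (realnorm (fourier_coef V p k (v i)) ^+ 2)%:C) * G).
      rewrite big_distrlr /= mulr_sumr.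
      under [RHS]eq_bigr do rewrite mulr_sumr.
      rewrite pair_bigA /=; apply: eq_bigr => a _.
      by rewrite /th mulrDl cisD; ring.
    rewrite !cmodM cmod_real ger0_norm ?invr_ge0 ?ler0n// !exprMn exprVn.
    rewrite mulrA ler_wpM2r ?sqr_ge0// mulrC ler_wpM2r ?invr_ge0 ?sqr_ge0//.
    rewrite -[4%N]/(2 * 2)%N exprM ler_pXn2r ?nnegrE ?cmod_ge0 ?sqr_ge0//.
    rewrite (le_trans (cmod_sum _ _ _ _))// /X -vi -sum_fourier_coef.
    apply: ler_sum => k _; rewrite cmodM cmod_cis mul1r cmod_real.
    by rewrite ger0_norm ?sqr_ge0.
  rewrite /gram_energy (le_trans (ler_sum _ (fun r _ => ler_sum _ (fun s _ => bd r s))))//.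
  under eq_bigr do rewrite -mulr_sumr; rewrite -mulr_sumr.
  rewrite dft_energy; last by rewrite /n leq_pmull.
  have -> : X ^+ 4 / D%:R ^+ 2 * (D%:R * n%:R ^+ 2) = n%:R ^+ 2 * X ^+ 4 / D%:R.
    by field; exact: lt0r_neq0.
  by [].
Qed.

End construction.
End core.

Section approx.
Context {R : realType} {H : completeNormedModType R[i]}.
Variable dot : {dot H for @Num.conj R[i]}.
Hypothesis dotE : forall u : H, `|u| ^+ 2 = dot u u.
Hypothesis Hinf : infinite_dimensional H.

(** The errors of the single steps add up, because S does not amplify them. *)
Lemma sg_iter_err (S T : isoC0semigroup H) (s t : {nonneg R}) u
    (L l : nat) (r : R) :
  (forall l, (l <= L)%N ->
    realnorm (S s (iter l (T t) u) - iter l.+1 (T t) u) <= r) ->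
  (l <= L.+1)%N ->
  realnorm (iter l (S s) u - iter l (T t) u) <= l%:R * r.
Proof.
move=> hr; elim: l => [|l IH] lL /=; first by rewrite subrr realnorm0 mul0r.
rewrite (le_trans (realnorm_distD (S s (iter l (T t) u)) _ _))//.
by rewrite -sgB sg_realnorm -natr1 mulrDl mul1r lerD ?IH ?(ltnW lL)// hr.
Qed.

(** A time t <= N is written l h + s with s < h.  The total error is made of l + 1
single step errors, which a large q makes small, and of the displacements of x_j
under T during a time at most h, which a small h makes small. *)
Lemma periodic_approx (T : isoC0semigroup H) (N J D n0 : nat) (x : nat -> H)
    (eta : R) : 0 < eta -> (0 < D)%N ->
  exists S : isoC0semigroup H, [/\
    forall j (t : {nonneg R}), (j < J)%N -> t%:num <= N%:R ->
      realnorm (S t (x j) - T t (x j)) <= eta,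
    exists2 t : R, n0%:R <= t & forall w, S (nngabs t) w = w &
    exists2 n, (0 < n)%N & forall j, (j < J)%N ->
      gram_energy dot S (x j) n <= n%:R ^+ 2 * realnorm (x j) ^+ 4 / D%:R].
Proof.
move=> eta0 D0.
have [M TM] := sg_small T J x (eta / 4) (divr_gt0 eta0 (ltr0n _ 4)).
set h : R := M.+1%:R^-1 in TM.
have h0 : 0 < h by rewrite invr_gt0 ltr0n.
pose L := (N * M.+1)%N; pose X := \sum_(j < J) realnorm (x j).
have xX j : (j < J)%N -> realnorm (x j) <= X.
  move=> jJ; rewrite /X (bigD1 (Ordinal jJ))//= lerDl.
  by apply: sumr_ge0 => i _; exact: realnorm_ge0.
have X0 : 0 <= X by apply: sumr_ge0 => i _; exact: realnorm_ge0.
pose r := eta / 2 / L.+1%:R.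
have r0 : 0 < r by rewrite !divr_gt0// ltr0n.
(* The bound 10 X^2 / q for the square of a single step error becomes at most
   r^2, where (L + 1) r = eta / 2. *)
pose p := Num.truncn (10 * X ^+ 2 / r ^+ 2).
have pq : 10 * X ^+ 2 / p.*2.+1%:R <= r ^+ 2.
  rewrite ler_pdivrMr ?ltr0n// [leRHS]mulrC -ler_pdivrMr ?exprn_gt0//.
  rewrite (le_trans (ltW (truncnS_gt _)))// ler_nat -/p; lia.
have [S [S1 S2 S3 S4]] := periodic_interpolation dot dotE Hinf T M p D L J x D0.
rewrite -/h in S1 S2; set V := T (nngabs h) in S1 S2.
exists S; split; last 1 first.
- by exists (8 * p.*2.+1 * D)%N => //; rewrite !muln_gt0.
- move=> j t jJ tN.
  have err l : (l <= L)%N ->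
      realnorm (S (nngabs h) (iter l V (x j)) - iter l.+1 V (x j)) <= r.
    move=> lL; rewrite -(@ler_pXn2r _ 2) ?nnegrE ?realnorm_ge0 ?(ltW r0)//.
    rewrite (le_trans (S1 _ _ jJ lL))// (le_trans _ pq)//.
    rewrite ler_wpM2r ?invr_ge0// ler_wpM2l//.
    by rewrite ler_pXn2r ?nnegrE ?realnorm_ge0// xX.
  have t0 : 0 <= t%:num by [].
  pose l := Num.truncn (t%:num * M.+1%:R).
  have /andP[l1 l2] : l%:R <= t%:num * M.+1%:R < l.+1%:R.
    by apply: truncn_itv; rewrite mulr_ge0.
  have lL : (l <= L)%N.
    by rewrite -(@ler_nat R) (le_trans l1)// natrM ler_wpM2r.
  pose s := t%:num - l%:R * h.
  have s0 : 0 <= s by rewrite subr_ge0 ler_pdivrMr ?ltr0n.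
  have sh : s <= h.
    by rewrite lerBlDr -[X in X + _]mul1r -mulrDl ler_pdivlMr ?ltr0n// addrC natr1 ltW.
  have lh : 0 <= l%:R * h by rewrite mulr_ge0// ltW.
  have St : S t (x j) = S (nngabs s) (iter l (S (nngabs h)) (x j)).
    by rewrite -sg_iter ?(ltW h0)// -sg_nngabsD// subrK nngabsE.
  have Tt : T t (x j) = iter l V (T (nngabs s) (x j)).
    by rewrite -sg_iter ?(ltW h0)// -sg_nngabsD// addrC subrK nngabsE.
  have VB u w : realnorm (iter l V u - iter l V w) = realnorm (u - w).
    by rewrite -!sg_iter ?(ltW h0)// -sgB sg_realnorm.
  have hM : (nngabs h)%:num <= h by rewrite nngabs_num// ltW.
  have sM : (nngabs s)%:num <= h by rewrite nngabs_num.
  have e1 := sg_iter_err S T (nngabs h) (nngabs h) (x j) L l r err (leqW lL).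
  have e2 := S2 j l (nngabs s) jJ lL sM.
  have e3 := err l lL.
  have e4 : realnorm (iter l.+1 V (x j) - iter l V (x j)) <= eta / 4.
    by rewrite iterSr VB; exact: TM.
  have e5 : realnorm (iter l V (x j) - T t (x j)) <= eta / 4.
    by rewrite Tt VB realnormB; exact: TM.
  have e6 := realnorm_distD (iter l.+1 V (x j)) (S (nngabs h) (iter l V (x j))) (iter l V (x j)).
  have e7 := realnorm_distD (S (nngabs s) (iter l V (x j))) (S t (x j)) (T t (x j)).
  have e8 := realnorm_distD (iter l V (x j)) (S (nngabs s) (iter l V (x j))) (T t (x j)).
  have e9 : realnorm (S t (x j) - S (nngabs s) (iter l V (x j))) <= l%:R * r.
    by rewrite St -sgB sg_realnorm.
  have e10 : l%:R * r + r <= eta / 2.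
    have <- : L.+1%:R * r = eta / 2 by rewrite mulrC divfK// pnatr_eq0.
    by rewrite -[X in _ + X]mul1r -mulrDl natr1 ler_wpM2r ?(ltW r0)// ler_nat.
  lra.
- exists (p.*2.+1 * (8 * p.*2.+1 * D) * n0)%N%:R => //.
  by rewrite ler_nat leq_pmull// !muln_gt0.
Qed.

End approx.

(** * The metric on semigroups *)

(** The metric enters only through two facts: closeness on finitely many x_j over a
bounded time interval implies closeness in the metric (sg_dist_small), and
conversely (sg_dist_pointwise).  The weights dist_weight bound the terms of the
series uniformly in the two semigroups, and have a finite sum. *)
Section metric.
Context {R : realType} {H : completeNormedModType R[i]}.
Variable x : dense_seq H.
Implicit Types S T : isoC0semigroup H.

Definition dist_term S T (p : nat * nat) : R :=
  sup_diff S T p.1.+1 (x p.2) / (2 ^+ (p.2.+1 + p.1.+1) * realnorm (x p.2)).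

Definition dist_weight (p : nat * nat) : R := 2 / 2 ^+ (p.2.+1 + p.1.+1).

Let den_gt0 (p : nat * nat) : 0 < 2 ^+ (p.2.+1 + p.1.+1) * realnorm (x p.2).
Proof. by rewrite mulr_gt0 ?exprn_gt0// realnorm_gt0// dseq_neq0. Qed.

Lemma dist_term_ge0 S T p : 0 <= dist_term S T p.
Proof. by rewrite divr_ge0 ?sup_diff_ge0// ltW. Qed.

Lemma dist_term_le S T p : dist_term S T p <= dist_weight p.
Proof.
rewrite /dist_term ler_pdivrMr// /dist_weight mulrA divfK ?expf_neq0//.
by apply: sup_diff_le => t _; exact: sg_diff_le.
Qed.

Lemma dist_weight_ge0 p : 0 <= dist_weight p.
Proof. by rewrite divr_ge0// exprn_ge0. Qed.

Lemma esum_dist_weight_fin :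
  (\esum_(p in [set: nat * nat]) (dist_weight p)%:E)%E \is a fin_num.
Proof.
have half (r : R) n : 0 <= r ->
    (\esum_(k in [set: nat]) (r / 2 ^+ (k + n.+1))%:E = (r / 2 ^+ n)%:E)%E.
  move=> r0; rewrite -nneseries_esumT; last first.
    by move=> k; rewrite lee_fin divr_ge0// exprn_ge0.
  apply/cvg_lim => //; under eq_fun do under eq_bigr do rewrite -natrX.
  exact: cvg_geometric_eseries_half.
have -> : [set: nat * nat] = [set: nat] `*`` (fun=> [set: nat]) by apply/seteqP.
rewrite -(@esum_esum _ _ _ _ _ (fun n j => (dist_weight (n, j))%:E)) => [|n j _ _]; last first.
  by rewrite lee_fin dist_weight_ge0.
rewrite /dist_weight /=; under eq_esum do under eq_esum do rewrite addSnnS.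
under eq_esum => i _ do rewrite half// -[i.+1]addn1.
by rewrite half.
Qed.

Lemma sg_distE S T :
  ((sg_dist x S T)%:E = \esum_(p in [set: nat * nat]) (dist_term S T p)%:E)%E.
Proof.
rewrite /sg_dist fineK// ge0_fin_numE; last first.
  by apply: esum_ge0 => p _; rewrite lee_fin dist_term_ge0.
apply: (@le_lt_trans _ _ (\esum_(p in [set: nat * nat]) (dist_weight p)%:E)%E).
  by apply: le_esum => p _; rewrite lee_fin dist_term_le.
by rewrite ltey_eq esum_dist_weight_fin.
Qed.

Lemma sg_dist_pointwise (j : nat) (t : {nonneg R}) : exists2 K : R, 0 < K &
  forall S T, realnorm (S t (x j) - T t (x j)) <= K * sg_dist x S T.
Proof.
pose n := Num.truncn t%:num; exists (2 ^+ (j.+1 + n.+1) * realnorm (x j)).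
  exact: (den_gt0 (n, j)).
move=> S T; apply: (@le_trans _ _ (sup_diff S T n.+1 (x j))).
  by apply: sup_diff_sup; rewrite ltW// truncnS_gt.
rewrite -ler_pdivrMl ?(den_gt0 (n, j))// mulrC -lee_fin sg_distE.
apply: esum_ge; exists [set (n, j)]; first by split => //; exact: finite_set1.
by rewrite fsbig_set1.
Qed.

(** A finite set X of indices carries all but e/2 of the total weight; the terms
outside X add up to at most e/2, and those in X are controlled by eta. *)
Lemma sg_dist_small (e : R) : 0 < e -> exists N J (eta : R), 0 < eta /\
  forall S T, (forall j (t : {nonneg R}), (j < J)%N -> t%:num <= N%:R ->
      realnorm (S t (x j) - T t (x j)) <= eta) ->
    sg_dist x S T <= e.
Proof.
move=> e0; have e2 : 0 < e / 2 by rewrite divr_gt0.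
have [_ [X [finX _] <-] WX] := ub_ereal_sup_adherent e2 esum_dist_weight_fin.
set W := ereal_sup _ in WX.
pose s : seq (nat * nat) := finmap.enum_fset (fset_set X).
pose N := \max_(p <- s) p.1.+1; pose J := \max_(p <- s) p.2.+1.
pose K := \sum_(p <- s) (2 ^+ (p.2.+1 + p.1.+1) * realnorm (x p.2))^-1.
have K0 : 0 <= K.
  by apply: sumr_ge0 => p _; rewrite invr_ge0 ltW.
exists N, J, (e / 2 / (K + 1)); split; first by rewrite divr_gt0// ltr_wpDl.
set eta := e / 2 / (K + 1).
have eta0 : 0 <= eta by rewrite divr_ge0// ?(ltW e2)// addr_ge0.
move=> S T ST; rewrite -lee_fin sg_distE (esumID X); last first.
  by move=> p _; rewrite lee_fin dist_term_ge0.
rewrite setTI [in X in (X + _)%E]esum_fset//; last first.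
  by move=> p _; rewrite lee_fin dist_term_ge0.
have W1 : (W = \esum_(p in X) (dist_weight p)%:E +
    \esum_(p in [set: nat * nat] `&` ~` X) (dist_weight p)%:E)%E.
  have := @esumID R _ X setT (fun p => (dist_weight p)%:E).
  by rewrite setTI; apply => p _; rewrite lee_fin dist_weight_ge0.
have W2 : (\esum_(p in X) (dist_weight p)%:E = \sum_(p \in X) (dist_weight p)%:E)%E.
  by rewrite esum_fset// => p _; rewrite lee_fin dist_weight_ge0.
have tail :
    (\esum_(p in [set: nat * nat] `&` ~` X) (dist_term S T p)%:E <= (e / 2)%:E)%E.
  apply: (@le_trans _ _ (\esum_(p in [set: nat * nat] `&` ~` X) (dist_weight p)%:E)%E).
    by apply: le_esum => p _; rewrite lee_fin dist_term_le.
  move: WX; rewrite W1 W2 fsbig_finite//= sumEFin.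
  set b := (\esum_(p in _ `&` _) _)%E.
  have : b \is a fin_num \/ b = +oo%E.
    have : (0 <= b)%E by apply: esum_ge0 => p _; rewrite lee_fin dist_weight_ge0.
    by case: b => // [? ? | ?]; [left|right].
  case => [/fineK <-|->]; last by rewrite addey// ltxx.
  rewrite -?EFinD -?EFinN -?EFinD lte_fin lee_fin; lra.
have head : (\sum_(p \in X) (dist_term S T p)%:E <= (e / 2)%:E)%E.
  rewrite fsbig_finite//= sumEFin lee_fin.
  apply: (@le_trans _ _ (eta * K)).
    rewrite mulr_sumr big_seq [leRHS]big_seq; apply: ler_sum => p ps.
    rewrite /dist_term ler_wpM2r ?invr_ge0 ?(ltW (den_gt0 _))//.
    apply: sup_diff_le => t tp; apply: ST.
      by rewrite /J (big_rem p)//= leq_max ltnSn.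
    by rewrite (le_trans tp)// ler_nat /N (big_rem p)//= leq_max leqnn.
  by rewrite /eta mulrAC ler_pdivrMr ?ltr_wpDl// ler_wpM2l ?(ltW e2)// lerDl.
by rewrite [e]splitr EFinD leeD.
Qed.

End metric.

(** * Density of sets of natural numbers *)

Section natdensity.
Context {R : realType}.

(** The initial segment of length N is covered by N/n + 1 blocks of length n. *)
Lemma block_density (f : nat -> R) (z : R) (n N : nat) :
  (forall i, 0 <= f i) -> 0 <= z -> (0 < n)%N -> (n <= N)%N ->
  (forall m, \sum_(i < n) f (m + i)%N <= z * n%:R) ->
  \sum_(i < N) f i <= 2 * z * N%:R.
Proof.
move=> f0 z0 n0 nN fz.
have B b : \sum_(i < b * n) f i <= z * (b * n)%N%:R.
  elim: b => [|b IH]; first by rewrite mul0n big_ord0 mulr0.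
  rewrite mulSn addnC big_split_ord /= natrD mulrDr lerD//.
have NB : (N <= (N %/ n).+1 * n)%N by rewrite ltnW// ltn_ceil.
apply: (@le_trans _ _ (\sum_(i < (N %/ n).+1 * n) f i)).
  by rewrite -(subnKC NB) big_split_ord /= lerDl sumr_ge0.
rewrite (le_trans (B _))// -mulrA mulrCA ler_wpM2l// -natrM ler_nat.
by rewrite mulSn mul2n -addnn leq_add// leq_divM.
Qed.

(** Let n_q be the time from which E q has relative frequency at most 1/(q+1), and
Q k the largest q <= k with n_q <= k.  The set B of the k that belong to E (Q k)
eventually contains each E q because Q tends to infinity.  Below N it is contained
in E (Q N) because Q and E are increasing, hence it has density zero. *)
Lemma diagonal_density (E : nat -> pred nat) :
  (forall q q' i, (q <= q')%N -> E q i -> E q' i) ->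
  (forall q (z : R), 0 < z -> exists n, forall N, (n <= N)%N ->
     \sum_(i < N) (E q i)%:R <= z * N%:R) ->
  exists B : pred nat,
    (forall z : R, 0 < z -> exists n, forall N, (n <= N)%N ->
       \sum_(i < N) (B i)%:R <= z * N%:R) /\
    (forall q, exists n, forall i, (n <= i)%N -> E q i -> B i).
Proof.
move=> Emon Ed.
have /choice[n nE] (q : nat) : exists n, forall N, (n <= N)%N ->
    \sum_(i < N) (E q i)%:R <= q.+1%:R^-1 * N%:R :> R.
  by apply: Ed; rewrite invr_gt0 ltr0n.
(* For k < n_0 the family may be empty, and the maximum is then the default value
   0; this is why Qn assumes n_0 <= k. *)
pose Q k := \max_(q < k.+1 | (n q <= k)%N) q.
have Qge q k : (q <= k)%N -> (n q <= k)%N -> (q <= Q k)%N.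
  move=> qk nk; have qk' : (q < k.+1)%N by [].
  exact: (@leq_bigmax_cond _ (fun i : 'I_k.+1 => n i <= k)%N
            (fun i => nat_of_ord i) (Ordinal qk') nk).
have Qmon k k' : (k <= k')%N -> (Q k <= Q k')%N.
  move=> kk; apply/bigmax_leqP => q nq; apply: Qge.
    by rewrite (leq_trans _ kk)// -ltnS.
  exact: leq_trans nq kk.
have Qn k : (n 0%N <= k)%N -> (n (Q k) <= k)%N.
  move=> n0k; rewrite /Q.
  have [|i ni ->] := @eq_bigmax_cond _ [pred q : 'I_k.+1 | n q <= k]%N
    (fun q => nat_of_ord q).
    by apply/card_gt0P; exists ord0; rewrite inE.
  by rewrite inE in ni.
exists (fun k => E (Q k) k); split.
  move=> z z0; pose q := Num.truncn z^-1.
  exists (maxn q (maxn (n q) (n 0%N))) => N; rewrite !geq_max => /and3P[qN nqN n0N].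
  apply: (@le_trans _ _ (\sum_(i < N) (E (Q N) i)%:R)).
    apply: ler_sum => i _; rewrite ler_nat.
    by case: (boolP (E (Q i) i)) => // /(Emon _ (Q N) _ (Qmon _ _ (ltnW (ltn_ord i)))) ->.
  rewrite (le_trans (nE _ _ (Qn _ n0N)))// ler_wpM2r//.
  rewrite invf_ple ?posrE ?ltr0n// (le_trans (ltW (truncnS_gt _)))// ler_nat ltnS.
  exact: Qge.
move=> q; exists (maxn q (n q)) => i; rewrite geq_max => /andP[qi ni].
by apply: Emon; exact: Qge.
Qed.

End natdensity.

Section density.
Context {R : realType} (B : pred nat).

(** The union of the intervals [k, k + 1[ for k outside B. *)
Definition truncn_set : set R := [set t | 0 <= t /\ ~~ B (Num.truncn t)].

Lemma truncn_set_itv k : truncn_set `&` `[k%:R, k.+1%:R[%classic =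
  if B k then set0 else `[k%:R, k.+1%:R[%classic.
Proof.
have tk t : `[k%:R, k.+1%:R[%classic t -> 0 <= t /\ Num.truncn t = k.
  rewrite /= in_itv /= => tk; split; last exact: truncn_def.
  by case/andP: tk => + _; apply: le_trans.
apply/seteqP; split => [t [[t0 Bt] /[dup] /tk[_ tE] tk']|t].
  by move: Bt; rewrite tE; case: (B k).
by case: ifP => // Bk /[dup] /tk[t0 tE] tk'; split => //; split => //; rewrite tE Bk.
Qed.

Lemma truncn_setE :
  truncn_set = \bigcup_k (truncn_set `&` `[k%:R, k.+1%:R[%classic).
Proof.
apply/seteqP; split => [t [t0 Bt]|t [k _ []//]].
by exists (Num.truncn t) => //; split => //=; rewrite in_itv /= truncn_itv.
Qed.

Lemma measurable_truncn_set_itv k :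
  measurable (truncn_set `&` `[k%:R, k.+1%:R[%classic).
Proof. by rewrite truncn_set_itv; case: ifP. Qed.

Lemma measurable_truncn_set : measurable truncn_set.
Proof.
rewrite truncn_setE; apply: bigcup_measurable => k _.
exact: measurable_truncn_set_itv.
Qed.

Lemma truncn_set_measure N :
  lebesgue_measure (truncn_set `&` `[0, N%:R[%classic) =
  (\sum_(k < N) (~~ B k)%:R)%:E.
Proof.
elim: N => [|N IH].
  rewrite big_ord0 (_ : _ `&` _ = set0) ?measure0//.
  apply/seteqP; split => t // [_] /=; rewrite in_itv /= => /andP[t0].
  by rewrite ltNge t0.
rewrite big_ord_recr EFinD -IH.
have -> : truncn_set `&` `[0, N.+1%:R[%classic =
    (truncn_set `&` `[0, N%:R[%classic) `|` (truncn_set `&` `[N%:R, N.+1%:R[%classic).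
  rewrite -setIUr; congr (_ `&` _); apply/seteqP; split => t /=; rewrite !in_itv /=.
    by move=> /andP[t0 tN]; have [h|h] := ltP t N%:R; [left|right]; apply/andP.
  case=> /andP[a b]; apply/andP; split => //.
    by rewrite (lt_trans b)// ltr_nat.
  exact: le_trans a.
rewrite measureU//.
- congr (_ + _)%E; rewrite truncn_set_itv; case: (B N); first by rewrite measure0.
  apply: etrans (lebesgue_measure_itv _) _.
  by rewrite /= lte_fin ltr_nat ltnSn -EFinB -natr1 addrAC subrr add0r.
- by apply: measurableI => //; exact: measurable_truncn_set.
- exact: measurable_truncn_set_itv.
- apply/seteqP; split => t // [[_ h1] [_ h2]]; move: h1 h2.
  rewrite /= !in_itv /= => /andP[_ h1] /andP[h2 _].
  by move: h1; rewrite ltNge h2.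
Qed.

(** The measure of the part of truncn_set below t lies between t and the number of
k below the integral part of t which are outside B. *)
Lemma truncn_set_density :
  (forall z : R, 0 < z -> exists n, forall N, (n <= N)%N ->
     \sum_(i < N) (B i)%:R <= z * N%:R) ->
  asymptotic_density_one truncn_set.
Proof.
move=> Bd; apply/cvgrPdist_le => e e0.
have z0 : 0 < e / 2 by rewrite divr_gt0.
have [n nB] := Bd _ z0.
near=> t.
have tn : n%:R <= t by near: t; apply: nbhs_pinfty_ge; rewrite num_real.
have t1 : 1 <= t by near: t; apply: nbhs_pinfty_ge; rewrite num_real.
have te : 2 / e <= t by near: t; apply: nbhs_pinfty_ge; rewrite num_real.
have t0 : 0 < t by rewrite (lt_le_trans _ t1).
pose N := Num.truncn t.
have /andP[Nt tN] : N%:R <= t < N.+1%:R by apply: truncn_itv; exact: ltW.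
have nN : (n <= N)%N by rewrite -ltnS -(ltr_nat R) (le_lt_trans tn).
have mF : measurable (truncn_set `&` `[0, t]%classic).
  by apply: measurableI => //; exact: measurable_truncn_set.
have up : (lebesgue_measure (truncn_set `&` `[0%R, t]%classic) <= t%:E)%E.
  have -> : t%:E = lebesgue_measure `[0%R, t]%classic.
    by rewrite lebesgue_measure_itv /= lte_fin t0 sube0.
  by apply: le_measure; rewrite ?inE//; exact: subIsetr.
have lo : ((\sum_(k < N) (~~ B k)%:R)%:E <=
    lebesgue_measure (truncn_set `&` `[0%R, t]%classic))%E.
  rewrite -truncn_set_measure; apply: le_measure; rewrite ?inE//.
    by apply: measurableI => //; exact: measurable_truncn_set.
  apply: setIS => s /=; rewrite !in_itv /= => /andP[-> sN] /=.
  by rewrite (le_trans (ltW sN)).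
have fin : lebesgue_measure (truncn_set `&` `[0%R, t]%classic) \is a fin_num.
  by rewrite ge0_fin_numE// (le_lt_trans up)// ltry.
move: up lo; rewrite -(fineK fin) !lee_fin; set m := fine _ => up lo.
have NB : \sum_(k < N) (~~ B k)%:R = N%:R - \sum_(k < N) (B k)%:R :> R.
  apply/eqP; rewrite eq_sym subr_eq -big_split /=; apply/eqP.
  rewrite (eq_bigr (fun=> 1)) ?sumr_const ?card_ord// => k _.
  by case: (B k); rewrite ?add0r ?addr0.
rewrite NB in lo.
have := nB N nN => nBN.
have zt : e / 2 * N%:R <= e / 2 * t by rewrite ler_wpM2l// ltW.
have te2 : 1 <= e / 2 * t.
  by move: te; rewrite ler_pdivrMr// => ?; lra.
have mt : (1 - e) * t <= m by move: tN; rewrite -natr1; lra.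
rewrite ger0_norm; last by rewrite subr_ge0 ler_pdivrMr// mul1r.
by rewrite lerBlDr -lerBlDl ler_pdivlMr.
Unshelve. all: by end_near. Qed.

End density.

(** * A criterion for almost weak stability *)

Section gram.
Context {R : realType} {H : completeNormedModType R[i]}.
Variable dot : {dot H for @Num.conj R[i]}.
Hypothesis dotE : forall u : H, `|u| ^+ 2 = dot u u.

(** Testing y against u = sum over k of conj <w_k,y> w_k gives Q = <u,y>, where Q is
the left-hand side, so that Q^2 <= |u|^2 |y|^2.  On the other hand |u|^2 is a
double sum against the Gram matrix, bounded by Q G by the Cauchy-Schwarz
inequality on the index set of pairs. *)
Lemma sum_sqr_dot_le_energy (n : nat) (w : nat -> H) (y : H) (G : R) : 0 < G ->
  \sum_(r < n) \sum_(s < n) cmod (dot (w r) (w s)) ^+ 2 <= G ^+ 2 ->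
  \sum_(k < n) cmod (dot (w k) y) ^+ 2 <= G * realnorm y ^+ 2.
Proof.
move=> G0 wG; set Q := leLHS.
pose c k := dot (w k) y; pose u := \sum_(k < n) (c k)^* *: w k.
have Q0 : 0 <= Q by apply: sumr_ge0 => k _; exact: sqr_ge0.
have uy : dot u y = Q%:C.
  rewrite /u linear_sumlz rmorph_sum /=; apply: eq_bigr => k _.
  by rewrite (dotZl dot) sqr_cmod mulrC.
have Qu : Q <= realnorm u * realnorm y.
  have := CauchySchwarz_dot dot dotE u y.
  by rewrite uy cmod_real ger0_norm.
have [Qz|Qp] := eqVneq Q 0; first by rewrite Qz mulr_ge0 ?sqr_ge0 ?ltW.
have {}Qp : 0 < Q by rewrite lt_neqAle eq_sym Qp.
have uu : realnorm u ^+ 2 <= Q * G.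
  rewrite (sqr_realnorm dot dotE) (le_trans (Re_le_cmod _))//.
  have -> : dot u u = \sum_(r < n) \sum_(s < n) (c r)^* * c s * dot (w r) (w s).
    rewrite {1}/u linear_sumlz /=; apply: eq_bigr => r _.
    rewrite (dotZl dot) /u linear_sumr mulr_sumr; apply: eq_bigr => s _ /=.
    by rewrite (dotZr dot) [((c s)^*)^*]conjcK mulrA.
  rewrite (le_trans (cmod_sum _ _ _ _))//.
  apply: (@le_trans _ _ (\sum_(r < n) \sum_(s < n)
      (cmod (c r) * cmod (c s) * cmod (dot (w r) (w s))))).
    apply: ler_sum => r _; rewrite (le_trans (cmod_sum _ _ _ _))//.
    by apply: ler_sum => s _; rewrite !cmodM cmodJ.
  (* Cauchy-Schwarz for the double sum in the form 2 (G a) (Q b) <= (G a)^2 + (Q b)^2,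
     summed over all pairs. *)
  rewrite -(@ler_pM2l _ (2 * Q * G)) ?mulr_gt0//.
  apply: (@le_trans _ _ (\sum_(r < n) \sum_(s < n)
     (G ^+ 2 * (cmod (c r) ^+ 2 * cmod (c s) ^+ 2) + Q ^+ 2 * cmod (dot (w r) (w s)) ^+ 2))).
    rewrite mulr_sumr; apply: ler_sum => r _; rewrite mulr_sumr; apply: ler_sum => s _.
    set a := cmod (c r); set b := cmod (c s); set g := cmod _.
    have := sqr_ge0 (G * (a * b) - Q * g); rewrite -subr_ge0 => /le_trans; apply.
    by rewrite le_eqVlt; apply/orP; left; apply/eqP; ring.
  under eq_bigr do rewrite big_split /= -!mulr_sumr.
  rewrite big_split /= -!mulr_sumr -mulr_suml -/Q.
  have := ler_wpM2l (sqr_ge0 Q) wG.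
  move=> h; rewrite (le_trans (lerD (lexx _) h))//.
  by rewrite le_eqVlt; apply/orP; left; apply/eqP; rewrite /Q /c; ring.
rewrite -(@ler_pM2l _ Q)// -expr2 mulrA.
apply: (@le_trans _ _ ((realnorm u * realnorm y) ^+ 2)).
  by rewrite ler_pXn2r ?nnegrE// mulr_ge0 ?realnorm_ge0.
by rewrite exprMn ler_wpM2r ?sqr_ge0.
Qed.

End gram.

Section aws.
Context {R : realType} {H : completeNormedModType R[i]}.
Variable dot : {dot H for @Num.conj R[i]}.
Hypothesis dotE : forall u : H, `|u| ^+ 2 = dot u u.
Variables (x : dense_seq H) (T : isoC0semigroup H).

(** The orbit of u over [0, 1] is compact, hence within d of finitely many x_j; a
finite net is given by the times l/(M+1). *)
Lemma orbit_approx (u : H) (d : R) : 0 < d -> exists q : nat,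
  forall s : R, 0 <= s -> s <= 1 ->
    exists2 j, (j <= q)%N & realnorm (T (nngabs s) u - x j) <= d.
Proof.
move=> d0; have d2 : 0 < d / 2 by rewrite divr_gt0.
have [M TM] := sg_small T 1 (fun=> u) _ d2.
have {}TM s := TM 0%N s (ltnSn 0); set h : R := M.+1%:R^-1 in TM.
have h0 : 0 < h by rewrite invr_gt0 ltr0n.
have /choice[f fE] l : exists j, realnorm (T (nngabs (l%:R * h)) u - x j) < d / 2.
  exact: dense_seq_approx.
exists (\max_(l < M.+2) f l)%N => s s0 s1.
pose l := Num.truncn (s * M.+1%:R).
have /andP[l1 l2] : l%:R <= s * M.+1%:R < l.+1%:R.
  by apply: truncn_itv; rewrite mulr_ge0.
have lM : (l < M.+2)%N.
  rewrite ltnS -(ler_nat R) (le_trans l1)// ler_piMl//.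
have s2 : 0 <= s - l%:R * h by rewrite subr_ge0 ler_pdivrMr ?ltr0n.
have sh : s - l%:R * h <= h.
  by rewrite lerBlDr -[X in X + _]mul1r -mulrDl ler_pdivlMr ?ltr0n// addrC natr1 ltW.
exists (f l); first exact: (@leq_bigmax _ (fun l : 'I_M.+2 => f l) (Ordinal lM)).
have lh : 0 <= l%:R * h by rewrite mulr_ge0// ltW.
have e1 : realnorm (T (nngabs s) u - T (nngabs (l%:R * h)) u) <= d / 2.
  have {1}-> : s = l%:R * h + (s - l%:R * h) by rewrite addrC subrK.
  rewrite sg_nngabsD// -sgB sg_realnorm.
  by apply: TM; rewrite nngabs_num.
have e2 := realnorm_distD (T (nngabs (l%:R * h)) u) (T (nngabs s) u) (x (f l)).
have := fE l; lra.
Qed.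

(** The times at which the orbit of one of the first q + 1 vectors is still
correlated with one of these vectors, the threshold and the range of vectors
being tied to the same q so that a single diagonal sequence treats all pairs. *)
Let badset q (i : nat) :=
  [exists j : 'I_q.+1, exists l : 'I_q.+1,
    (q.+1%:R^-1 < cmod (dot (T (nngabs i%:R) (x j)) (x l)))].

Let badset_mon q q' i : (q <= q')%N -> badset q i -> badset q' i.
Proof.
move=> qq /existsP[j /existsP[l jl]].
apply/existsP; exists (widen_ord (qq : (q.+1 <= q'.+1)%N) j).
apply/existsP; exists (widen_ord (qq : (q.+1 <= q'.+1)%N) l).
by rewrite (le_lt_trans _ jl)// lef_pV2 ?posrE// ler_nat.
Qed.

Hypothesis Tenergy : forall k : nat, exists2 n, (0 < n)%N &
  forall j, (j <= k)%N ->
    gram_energy dot T (x j) n <= n%:R ^+ 2 * realnorm (x j) ^+ 4 / k.+1%:R ^+ 2.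

(** The bound does not depend on m, because the Gram matrix of the orbit is invariant
under time translation. *)
Let block k : exists2 n, (0 < n)%N & forall j m y, (j <= k)%N ->
  \sum_(i < n) cmod (dot (T (nngabs (m + i)%N%:R) (x j)) y) ^+ 2 <=
  n%:R * realnorm (x j) ^+ 2 / k.+1%:R * realnorm y ^+ 2.
Proof.
have [n n0 nT] := Tenergy k; exists n => // j m y jk.
apply: (@sum_sqr_dot_le_energy _ _ dot dotE n (fun i => T (nngabs (m + i)%N%:R) (x j))).
  rewrite divr_gt0 ?ltr0n// mulr_gt0 ?ltr0n// exprn_gt0// realnorm_gt0//.
  exact: dseq_neq0.
have -> : (n%:R * realnorm (x j) ^+ 2 / k.+1%:R) ^+ 2 =
    n%:R ^+ 2 * realnorm (x j) ^+ 4 / k.+1%:R ^+ 2.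
  by rewrite -exprVn; ring.
rewrite (le_trans _ (nT j jk))// /gram_energy.
apply: ler_sum => r _; apply: ler_sum => s _.
by rewrite !natrD !sg_nngabsD// (sg_dot_isometry dot dotE).
Qed.

(** Chebyshev: on each block, the number of bad times is at most (q+1)^2 times the
sum of the squared correlations. *)
Let badset_density q (z : R) : 0 < z -> exists n, forall N, (n <= N)%N ->
  \sum_(i < N) (badset q i)%:R <= z * N%:R.
Proof.
move=> z0.
pose C : R := q.+1%:R ^+ 2 *
  \sum_(j < q.+1) \sum_(l < q.+1) realnorm (x j) ^+ 2 * realnorm (x l) ^+ 2.
have C0 : 0 <= C.
  rewrite mulr_ge0 ?sqr_ge0// sumr_ge0// => j _; rewrite sumr_ge0// => l _.
  by rewrite mulr_ge0 ?sqr_ge0.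
pose k := maxn q (Num.truncn (2 * C / z)).
have kC : C / k.+1%:R <= z / 2.
  have : 2 * C / z <= k.+1%:R.
    by rewrite (le_trans (ltW (truncnS_gt _)))// ler_nat ltnS leq_maxr.
  by rewrite !ler_pdivrMr ?ltr0n// => ?; lra.
have [n n0 nT] := block k.
exists n => N nN; have -> : z = 2 * (z / 2) by rewrite mulrC divfK.
apply: (@block_density R (fun i => (badset q i)%:R) _ n) => //.
  by rewrite divr_ge0// ltW.
move=> m; rewrite (le_trans _ (ler_wpM2r _ kC))//.
apply: (@le_trans _ _ (\sum_(i < n) \sum_(j < q.+1) \sum_(l < q.+1)
   q.+1%:R ^+ 2 * cmod (dot (T (nngabs (m + i)%N%:R) (x j)) (x l)) ^+ 2)).
  apply: ler_sum => i _; case: (boolP (badset q (m + i)%N)) => [|_]; last first.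
    apply: sumr_ge0 => j _; apply: sumr_ge0 => l _.
    by rewrite mulr_ge0 ?sqr_ge0.
  move=> /existsP[j /existsP[l jl]].
  rewrite (bigD1 j) //= (bigD1 l) //= -addrA ler_wpDr//.
    rewrite addr_ge0 ?sumr_ge0// => [l' _|j' _]; first by rewrite mulr_ge0 ?sqr_ge0.
    by apply: sumr_ge0 => l' _; rewrite mulr_ge0 ?sqr_ge0.
  rewrite -exprMn expr_ge1// ?mulr_ge0 ?cmod_ge0//.
  by rewrite mulrC -ler_pdivrMr ?ltr0n// mul1r ltW.
rewrite exchange_big /= /C mulr_sumr !mulr_suml; apply: ler_sum => j _.
rewrite exchange_big /= mulr_sumr !mulr_suml; apply: ler_sum => l _.
have jk : (j <= k)%N by rewrite /k leq_max -ltnS ltn_ord.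
rewrite -mulr_sumr; apply: le_trans (ler_wpM2l (sqr_ge0 _) (nT j m (x l) jk)) _.
by rewrite le_eqVlt; apply/orP; left; apply/eqP; ring.
Qed.

(** Outside the exceptional set of times given by diagonal_density, with t = k + s,
the vector T(s)u is replaced by a close x_j and v by a close x_l, after which
<T(k)x_j, x_l> is small because k is not bad. *)
Lemma almost_weakly_stable_of_energy : almost_weakly_stable dot T.
Proof.
have [B [Bd BE]] := @diagonal_density R badset badset_mon badset_density.
exists (truncn_set B); split.
- exact: measurable_truncn_set.
- by move=> t [t0 _]; rewrite /= in_itv /= t0.
- exact: truncn_set_density.
move=> u v; apply/cvgrPdist_le => _ /posC[e e0 ->].
pose Y := 2 * realnorm v + realnorm u + 2.
have Y0 : 0 < Y by have := realnorm_ge0 u; have := realnorm_ge0 v; rewrite /Y; lra.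
pose d := Num.min 1 (e / 2 / Y).
have d0 : 0 < d by rewrite lt_min ltr01 !divr_gt0.
have d1 : d <= 1 by rewrite ge_min lexx.
have dY : d * Y <= e / 2 by rewrite -ler_pdivlMr// ge_min lexx orbT.
have [q1 q1E] := orbit_approx u d d0.
have [l vl] := dense_seq_approx x v d0.
pose q := maxn (maxn q1 l) (Num.truncn (2 / e)).
have qe : q.+1%:R^-1 <= e / 2.
  rewrite invf_ple ?posrE ?ltr0n ?divr_gt0// invf_div.
  by rewrite (le_trans (ltW (truncnS_gt _)))// ler_nat ltnS leq_maxr.
have [n nB] := BE q.
have big : \forall t \near +oo, n%:R <= (t : R).
  by apply: nbhs_pinfty_ge; rewrite num_real.
near=> t; have [t0 Bt] : truncn_set B t by near: t; exact: withinT.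
have tn : n%:R <= t.
  by near: t; exact: (@cvg_within _ (+oo : set_system R) _ _ _ big).
rewrite sub0r normrN cmodE lecR.
pose k := Num.truncn t.
have /andP[kt tk] : k%:R <= t < k.+1%:R by exact: truncn_itv.
have nk : (n <= k)%N by rewrite -ltnS -(ltr_nat R) (le_lt_trans tn).
have nE : ~~ badset q k by apply: contra Bt; exact: nB.
have s0 : 0 <= t - k%:R by rewrite subr_ge0.
have s1 : t - k%:R <= 1 by move: tk; rewrite -natr1; lra.
have [j jq uj] := q1E _ s0 s1.
have -> : T (nngabs t) u = T (nngabs k%:R) (T (nngabs (t - k%:R)) u).
  by rewrite -sg_nngabsD// addrC subrK.
set u' := T _ u in uj *; set V := T (nngabs k%:R).
have small : cmod (dot (V (x j)) (x l)) <= e / 2.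
  rewrite (le_trans _ qe)// leNgt; apply: contra nE => jl.
  have jq' : (j < q.+1)%N by rewrite ltnS /q !leq_max jq.
  have lq' : (l < q.+1)%N by rewrite ltnS /q !leq_max leqnn orbT.
  by apply/existsP; exists (Ordinal jq'); apply/existsP; exists (Ordinal lq').
have -> : dot (V u') v =
    dot (V (u' - x j)) v + (dot (V (x j)) (v - x l) + dot (V (x j)) (x l)).
  by rewrite -(dotDr dot) subrK -(dotDl dot) /V sgB subrK.
have CS a b : cmod (dot (V a) b) <= realnorm a * realnorm b.
  by rewrite -(sg_realnorm T (nngabs k%:R) a) CauchySchwarz_dot.
have c1 := CS (u' - x j) v; have c2 := CS (x j) (v - x l).
have nx : realnorm (x j) <= realnorm u + d.
  have := realnormD (x j - u') u'; rewrite subrK sg_realnorm realnormB.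
  by move: uj; lra.
have c3 : realnorm (u' - x j) * realnorm v <= d * realnorm v.
  by rewrite ler_wpM2r ?realnorm_ge0.
have c4 : realnorm (x j) * realnorm (v - x l) <= (realnorm u + d) * d.
  by apply: ler_pM; rewrite ?realnorm_ge0// ltW.
have c5 := cmodD (dot (V (u' - x j)) v) (dot (V (x j)) (v - x l) + dot (V (x j)) (x l)).
have c6 := cmodD (dot (V (x j)) (v - x l)) (dot (V (x j)) (x l)).
have c7 : d * d <= d by rewrite ler_piMl// ltW.
have c8 : 0 <= d * realnorm v by rewrite mulr_ge0 ?realnorm_ge0 ?ltW.
move: dY; rewrite /Y !mulrDr mulrDl in c4 *; lra.
Unshelve. all: by end_near. Qed.

End aws.

(** * Baire category *)

Section category.
Context {R : realType} {H : completeNormedModType R[i]}.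
Variable dot : {dot H for @Num.conj R[i]}.
Hypothesis dotE : forall u : H, `|u| ^+ 2 = dot u u.
Variable x : dense_seq H.

(** Every ball contains an S around which a smaller ball misses A, so that no ball is
contained in the closure of A. *)
Lemma nowhere_dense_approx (A : set (isoSg x)) :
  (forall (T : isoC0semigroup H) (N J : nat) (eta : R), 0 < eta ->
    exists S : isoC0semigroup H,
      (forall j (t : {nonneg R}), (j < J)%N -> t%:num <= N%:R ->
        realnorm (S t (x j) - T t (x j)) <= eta) /\
      (exists2 d, 0 < d &
         forall U : isoC0semigroup H, sg_dist x S U < d -> ~ A U)) ->
  nowhere_dense A.
Proof.
move=> hA; apply/seteqP; split => // T /nbhs_ballP[r /= r0 rA].
have [N [J [eta [eta0 small]]]] := sg_dist_small x (r / 2) (divr_gt0 r0 (ltr0n _ 2)).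
have [S [ST [d d0 dA]]] := hA T N J eta eta0.
have : closure A S.
  apply: rA; rewrite ballEmdist /=.
  have := small S T ST; rewrite sg_dist_sym => h.
  by apply: (le_lt_trans h); rewrite ltr_pdivrMr// ltr_pMr// ltr1n.
move=> /(_ _ (nbhsx_ballx (S : isoSg x) d d0))[U [AU]].
rewrite ballEmdist /= => SU; exact: dA SU AU.
Qed.

Lemma sg_dist_finite (J n : nat) (eta : nat -> R) : (forall j, 0 < eta j) ->
  exists2 d : R, 0 < d & forall S U : isoC0semigroup H, sg_dist x S U < d ->
    forall j r, (j < J)%N -> (r < n)%N ->
      realnorm (S (nngabs r%:R) (x j) - U (nngabs r%:R) (x j)) <= eta j.
Proof.
move=> eta0.
have /choice[K KE] (p : nat * nat) : exists K : R, 0 < K /\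
    forall S T : isoC0semigroup H, realnorm (S (nngabs p.2%:R) (x p.1) -
      T (nngabs p.2%:R) (x p.1)) <= K * sg_dist x S T.
  by have [K ? ?] := sg_dist_pointwise x p.1 (nngabs p.2%:R); exists K.
pose B : R := \sum_(j < J) \sum_(r < n) K (nat_of_ord j, nat_of_ord r) / eta j.
have K0 p : 0 <= K p by have [/ltW] := KE p.
have B0 : 0 <= B.
  by apply: sumr_ge0 => j _; apply: sumr_ge0 => r _; rewrite divr_ge0// ltW.
exists (B + 1)^-1; first by rewrite invr_gt0 ltr_wpDl.
move=> S U SU j r jJ rn; have [_ /(_ S U) /= h] := KE (j, r).
rewrite (le_trans h)//.
apply: (@le_trans _ _ (K (j, r) * (B + 1)^-1)); first by rewrite ler_wpM2l// ltW.
rewrite ler_pdivrMr ?ltr_wpDl// -ler_pdivrMl// mulrC.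
apply: (@le_trans _ _ B); last by rewrite lerDl.
rewrite /B (bigD1 (Ordinal jJ)) //= (bigD1 (Ordinal rn)) //= -addrA lerDl.
have Ke a b : 0 <= K (a, b) / eta a by rewrite divr_ge0// ltW.
by rewrite addr_ge0// sumr_ge0// => i _; rewrite sumr_ge0.
Qed.

Hypothesis Hinf : infinite_dimensional H.

(** The set N m below contains no semigroup close to one which returns to the
identity at a time after m. *)
Lemma weakly_stable_first_category :
  first_category [set T : isoSg x | weakly_stable dot T].
Proof.
pose u := x 0%N; have u0 : 0 < realnorm u by rewrite realnorm_gt0// dseq_neq0.
pose N m : set (isoSg x) := [set T | forall t : R, m%:R <= t ->
   cmod (dot ((T : isoC0semigroup H) (nngabs t) u) u) <= realnorm u ^+ 2 / 2].
exists (fun m => [set T | weakly_stable dot T] `&` N m); split; last first.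
  apply/seteqP; split => [T WT|T [m _ []//]].
  have e0 : 0 < (realnorm u ^+ 2 / 2)%:C by rewrite ltcR divr_gt0// exprn_gt0.
  have /cvgrPdist_le/(_ _ e0) := WT u u.
  move=> [M [_ hM]]; exists (Num.truncn M).+1 => //; split=> // t Mt.
  have := hM t; rewrite sub0r normrN cmodE lecR; apply.
  by rewrite (lt_le_trans (truncnS_gt M)).
move=> m; apply: nowhere_dense_approx => T N0 J eta eta0.
have [S [S1 [t tm St] _]] := periodic_approx dot dotE Hinf T N0 J 1 m x eta eta0 isT.
exists S; split => //.
have [K K0 KE] := sg_dist_pointwise x 0%N (nngabs t).
exists (realnorm u / 2 / K); first by rewrite !divr_gt0.
move=> U SU [_ /(_ t tm)]; apply/negP; rewrite -ltNge.
have h := KE S U; rewrite St -/u in h.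
have h2 : realnorm (u - U (nngabs t) u) < realnorm u / 2.
  by rewrite (le_lt_trans h)// mulrC -ltr_pdivlMr.
have e : dot u u = dot (u - U (nngabs t) u) u + dot (U (nngabs t) u) u.
  by rewrite -(dotDl dot) subrK.
have := cmodD (dot (u - U (nngabs t) u) u) (dot (U (nngabs t) u) u).
rewrite -e (dot_sqr dot dotE) cmod_real ger0_norm ?sqr_ge0//.
have := CauchySchwarz_dot dot dotE (u - U (nngabs t) u) u.
have : realnorm (u - U (nngabs t) u) * realnorm u < realnorm u / 2 * realnorm u.
  by rewrite ltr_pM2r.
rewrite expr2; lra.
Qed.

(** A semigroup S with energies below n^2 |x_j|^4 / D, where D = 4 (k+1)^2, lies
outside C k with a margin, and the energy for this n depends only on S at finitely
many times, hence varies little near S. *)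
Lemma almost_weakly_stable_residual :
  residual [set T : isoSg x | almost_weakly_stable dot T].
Proof.
pose C k : set (isoSg x) := [set T | forall n, (0 < n)%N -> exists2 j, (j <= k)%N &
   n%:R ^+ 2 * realnorm (x j) ^+ 4 / k.+1%:R ^+ 2 < gram_energy dot T (x j) n].
exists (fun k => ~` [set T | almost_weakly_stable dot T] `&` C k); split; last first.
  apply/seteqP; split => [T nT|T [k _ []//]].
  apply: contrapT => nC; apply: (nT); apply: (almost_weakly_stable_of_energy dot dotE x T) => k.
  apply: contrapT => nk; apply: nC; exists k => //; split; first exact: nT.
  move=> n n0; apply: contrapT => nj; apply: nk; exists n => // j jk.
  by rewrite leNgt; apply/negP => lt; apply: nj; exists j.
move=> k; apply: nowhere_dense_approx => T N0 J eta eta0.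
pose D := (4 * k.+1 ^ 2)%N.
have D0 : (0 < D)%N by rewrite muln_gt0 expn_gt0.
have [S [S1 _ [n n0 Sn]]] :=
  periodic_approx dot dotE Hinf T N0 (maxn J k.+1) D 0 x eta eta0 D0.
exists S; split; first by move=> j t jJ; apply: S1; rewrite leq_max jJ.
pose et j := realnorm (x j) / (4 * k.+1%:R).
have et0 j : 0 < et j.
  by rewrite divr_gt0 ?mulr_gt0 ?ltr0n// realnorm_gt0// dseq_neq0.
have [d d0 dS] := sg_dist_finite k.+1 n et et0.
exists d => // U SU [_ /(_ n n0) [j jk]]; apply/negP; rewrite -leNgt.
have jk' : (j < maxn J k.+1)%N by rewrite leq_max ltnS jk orbT.
have {}Sn := Sn j jk'; have {}dS r rn := dS S U SU j r jk rn.
set X := realnorm (x j) in Sn *; pose c : R := k.+1%:R.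
have c0 : 0 < c by rewrite ltr0n.
have DE : D%:R = 4 * c ^+ 2 :> R by rewrite /D natrM natrX.
have X0 : 0 <= X by exact: realnorm_ge0.
(* The energy of S enters with a factor 2 and uses up half of the allowed amount;
   the other half is left for the difference between U and S. *)
have cls (r s : 'I_n) :
    cmod (dot (U (nngabs r%:R) (x j)) (U (nngabs s%:R) (x j))) ^+ 2 <=
    2 * cmod (dot (S (nngabs r%:R) (x j)) (S (nngabs s%:R) (x j))) ^+ 2 +
    X ^+ 4 / (2 * c ^+ 2).
  set a := U _ _; set b := U _ _; set a' := S _ _; set b' := S _ _.
  have e : dot a b = dot a' b' - (dot (a' - a) b' + dot a (b' - b)).
    by rewrite linearBl /= linearBr /=; ring.
  have h1 : cmod (dot (a' - a) b') <= et j * X.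
    rewrite (le_trans (CauchySchwarz_dot dot dotE _ _))// sg_realnorm.
    by rewrite ler_wpM2r// dS.
  have h2 : cmod (dot a (b' - b)) <= et j * X.
    rewrite (le_trans (CauchySchwarz_dot dot dotE _ _))// sg_realnorm mulrC.
    by rewrite ler_wpM2r// dS.
  have h3 := cmodD (dot a' b') (- (dot (a' - a) b' + dot a (b' - b))).
  rewrite -e cmodN in h3.
  have h4 := cmodD (dot (a' - a) b') (dot a (b' - b)).
  have y0 : 0 <= et j * X by rewrite mulr_ge0// ltW.
  have -> : X ^+ 4 / (2 * c ^+ 2) = 2 * (2 * (et j * X)) ^+ 2.
    by rewrite /et -/X -/c; field; rewrite gt_eqF.
  set y := et j * X in h1 h2 y0 *; set A := cmod (dot a' b') in h3 *.
  have A0 : 0 <= A by exact: cmod_ge0.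
  have h5 : cmod (dot a b) <= A + 2 * y by lra.
  have : cmod (dot a b) ^+ 2 <= (A + 2 * y) ^+ 2.
    by rewrite ler_pXn2r ?nnegrE ?cmod_ge0//; lra.
  by have := sqr_ge0 (A - 2 * y); nra.
rewrite /gram_energy (le_trans (ler_sum _ (fun r _ => ler_sum _ (fun s _ => cls r s))))//.
under eq_bigr do rewrite big_split /= -mulr_sumr sumr_const card_ord.
rewrite big_split /= -mulr_sumr sumr_const card_ord -/(gram_energy dot S (x j) n).
rewrite -mulrnA -[_ *+ (n * n)]mulr_natr.
have h : 2 * gram_energy dot S (x j) n <= 2 * (n%:R ^+ 2 * X ^+ 4 / D%:R) by rewrite ler_wpM2l.
rewrite (le_trans (lerD h (lexx _)))// DE natrM le_eqVlt.
apply/orP; left; apply/eqP; rewrite -/c; field; exact: lt0r_neq0.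
Qed.

End category.

Theorem theorem3p5 (R : realType) (H : completeNormedModType R[i])
    (dot : {dot H for @Num.conj R[i]})
    (dotE : forall u : H, `|u| ^+ 2 = dot u u)
    (Hsep : separable H) (Hinf : infinite_dimensional H)
    (x : dense_seq H) :
  first_category [set T : isoSg x | weakly_stable dot T] /\
  residual [set T : isoSg x | almost_weakly_stable dot T].
Proof.
split; first exact: weakly_stable_first_category.
exact: almost_weakly_stable_residual.
Qed.
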